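(* Let $A:\ell_2\to\ell_2$ be a bounded, positive, self-adjoint operator and let $$D:=\sum_k\sqrt{\langle A\delta_k,\delta_k\rangle}\in[0,\infty].$$ (A) If $D<\infty$, then $A^{1/2}\in\Pi_2(\ell_2,\ell_1)$ with $\pi_2(A^{1/2})\le D$. Moreover, $A\in\Gamma_+$ with $\gamma_+(A)\le D^2$. (B) If $A^{1/2}\in\Pi_2(\ell_2,\ell_1)$ (so that $A\in\Gamma_+$), then $D\le\kappa_G\cdot\pi_2(A^{1/2})$, where $\kappa_G$ is the Grothendieck constant.
   Context: Scalars are $\mathbb{R}$ or $\mathbb{C}$; $\ell_p=\ell_p(\mathbb{N})$ with standard basis $(\delta_k)$; for $x\in\ell_1\subset\ell_2$, $xx^*$ is the rank-one operator $v\mapsto\langle v,x\rangle x$. $\Gamma$ is the set of bounded self-adjoint operators $A:\ell_2\to\ell_2$ with $\langle Ax,x\rangle\ge0$ for all $x\in\ell_2$ and $\|A\|_{1,1}:=\sum_{k,l}|\langle A\delta_k,\delta_l\rangle|<\infty$. For $A\in\Gamma$, $\gamma_+(A):=\inf\{\sum_{k=1}^\infty\|x_k\|_1^2: (x_k)\subset\ell_1,\ A=\sum_{k=1}^\infty x_kx_k^*\text{ strongly}\}$ with $\inf\varnothing=\infty$, and $\Gamma_+:=\{A\in\Gamma:\gamma_+(A)<\infty\}$. A linear operator $T:X\to Y$ between Banach spaces is 2-summing if there is $C\ge0$ such that for every finite collection $x_1,\dots,x_N\in X$, $\sum_{k=1}^N\|Tx_k\|_Y^2\le C^2\sup_{x^*\in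 B_{X^*}}\sum_{k=1}^N|\langle x^*,x_k\rangle|^2$, where $B_{X^*}$ is the closed unit ball of $X^*$; the infimum of such $C$ is $\pi_2(T)$, and $\Pi_2(X,Y)$ is the space of 2-summing operators. $A^{1/2}$ is the positive square root of $A$ on $\ell_2$; $A^{1/2}\in\Pi_2(\ell_2,\ell_1)$ means that $A^{1/2}$ maps $\ell_2$ into $\ell_1$ and is 2-summing as such. The Grothendieck constant $\kappa_G$ is the smallest constant $K$ such that for all $n$, all $n\times n$ scalar matrices $(a_{ij})$ and all unit vectors $u_i,v_j$ in a Hilbert space, $|\sum a_{ij}\langle u_i,v_j\rangle|\le K\sup\{|\sum a_{ij}s_it_j|:|s_i|\le1,|t_j|\le1\}$. *)

(* Defs.v *)
From HB Require Import structures.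
From mathcomp Require Import all_boot all_order all_algebra.
From mathcomp Require Import complex.
From mathcomp Require Import all_classical all_reals all_analysis.
From mathcomp Require Import ring.

Set Implicit Arguments.
Unset Strict Implicit.
Unset Printing Implicit Defensive.
Import Order.TTheory GRing.Theory Num.Theory.
Import numFieldNormedType.Exports.
Local Open Scope classical_set_scope.
Local Open Scope ring_scope.

Variant scalar_kind := RealScalars | ComplexScalars.

Section Scalars.
Context (R : realType).

Definition scalars (k : scalar_kind) : numFieldType :=
  match k with RealScalars => R | ComplexScalars => R[i] end.

Definition conjS (k : scalar_kind) : scalars k -> scalars k :=
  match k with
  | RealScalars => fun x => x
  | ComplexScalars => fun x : R[i] => conjc x
  end.

Definition reS (k : scalar_kind) : scalars k -> R :=
  match k with
  | RealScalars => fun x => x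
  | ComplexScalars => fun x : R[i] => complex.Re x
  end.

Definition ofR (k : scalar_kind) : R -> scalars k :=
  match k with
  | RealScalars => fun x => x
  | ComplexScalars => fun x => Complex x 0
  end.

Variable k : scalar_kind.
Local Notation K := (scalars k).

Lemma reS_ofR (x : R) : reS (ofR k x) = x.
Proof. by case: k. Qed.

Lemma ofR_reS (x : K) : 0 <= x -> ofR k (reS x) = x.
Proof.
case: k x => //= -[a b] /=; rewrite lecE /= => /andP[/eqP <- _].
by [].
Qed.

Lemma ofR_ge0 (x : R) : (0 <= ofR k x) = (0 <= x).
Proof. by case: k => //=; rewrite lecE /= eqxx. Qed.

Lemma ler_ofR (x y : R) : (ofR k x <= ofR k y) = (x <= y).
Proof. by case: k => //=; rewrite lecE /= eqxx. Qed.

Lemma ofRD (x y : R) : ofR k (x + y) = ofR k x + ofR k y.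
Proof. by case: k => //=; apply/eqP; rewrite eq_complex /= addr0 !eqxx. Qed.

Lemma ofRM (x y : R) : ofR k (x * y) = ofR k x * ofR k y.
Proof.
case: k => //=; apply/eqP.
by rewrite eq_complex /= mulr0 mul0r mulr0 subr0 addr0 !eqxx.
Qed.

Lemma ofR0 : ofR k 0 = 0.
Proof. by case: k. Qed.

End Scalars.

(* Norms of [normedModType (scalars R k)] take values in the scalar field;
   [rnorm] is the same norm seen as an element of [R]. *)
Notation rnorm x := (reS (Num.norm x)).

Section ScalarNorm.
Context (R : realType) (k : scalar_kind).
Local Notation K := (scalars R k).

Lemma ofR_rnorm (V : normedModType K) (x : V) : ofR k (rnorm x) = `|x|.
Proof. exact/ofR_reS/normr_ge0. Qed.

Lemma ofR_rnormS (x : K) : ofR k (rnorm x) = `|x|.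
Proof. exact/ofR_reS/normr_ge0. Qed.

Lemma rnormS_ge0 (x : K) : 0 <= rnorm x.
Proof. by rewrite -(ofR_ge0 k) ofR_rnormS. Qed.

Lemma rnormS0 : rnorm (0 : K) = 0.
Proof. by rewrite normr0 -(ofR0 R k) reS_ofR. Qed.

Lemma rnormS_eq0 (x : K) : rnorm x = 0 -> x = 0.
Proof. by move=> x0; apply: normr0_eq0; rewrite -ofR_rnormS x0 ofR0. Qed.

Lemma rnormSM (x y : K) : rnorm (x * y) = rnorm x * rnorm y.
Proof. by rewrite normrM -{1}(ofR_rnormS x) -{1}(ofR_rnormS y) -ofRM reS_ofR. Qed.

Lemma rnormSD (x y : K) : rnorm (x + y) <= rnorm x + rnorm y.
Proof. by rewrite -(ler_ofR k) ofRD !ofR_rnormS ler_normD. Qed.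

End ScalarNorm.

Section LpSequences.
Context (R : realType) (k : scalar_kind).
Local Notation K := (scalars R k).

Definition lp_sum (p : R) (x : nat -> K) : \bar R :=
  (\sum_(0 <= n <oo) (rnorm (x n) `^ p)%:E)%E.

Definition lp_norm (p : R) (x : nat -> K) : \bar R :=
  (lp_sum p x `^ p^-1)%E.

Definition lp_pred (p : R) : {pred nat -> K} :=
  fun x => `[< (lp_sum p x < +oo)%E >].

Section Theory.
Variables (p : R) (p1 : 1 <= p).

Let p_gt0 : 0 < p. Proof. exact: lt_le_trans ltr01 p1. Qed.
Let p_neq0 : p != 0. Proof. by rewrite gt_eqF. Qed.

Lemma lp_sum_ge0 x : (0 <= lp_sum p x)%E.
Proof. by apply: nneseries_ge0 => n _ _; rewrite lee_fin powR_ge0. Qed.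

Lemma lp_norm_ge0 x : (0 <= lp_norm p x)%E.
Proof. exact: poweR_ge0. Qed.

Lemma lp_normE x :
  lp_norm p x = Lnorm counting p%:E (fun n => (rnorm (x n))%:E).
Proof.
rewrite Lnorm_counting//; congr (_ `^ _)%E.
apply: eq_eseriesr => n _ /=.
by rewrite (ger0_norm (rnormS_ge0 _)).
Qed.

Lemma lp_predP x : reflect (lp_sum p x < +oo)%E (x \in lp_pred p).
Proof. exact: asboolP. Qed.

Lemma lp_norm_lty x : (lp_norm p x < +oo)%E = (x \in lp_pred p).
Proof.
apply/idP/lp_predP; first exact/lty_poweRy/invr_neq0.
exact: poweR_lty.
Qed.

Lemma lp_normZ (a : K) x :
  lp_norm p (fun n => a * x n) = ((rnorm a)%:E * lp_norm p x)%E.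
Proof.
have -> : lp_norm p (fun n => a * x n) =
    (((rnorm a `^ p)%:E * lp_sum p x) `^ p^-1)%E.
  congr (_ `^ _)%E; rewrite -nneseriesZl//; last first.
    by move=> n _; rewrite lee_fin powR_ge0.
  apply: eq_eseriesr => n _.
  by rewrite rnormSM powRM ?rnormS_ge0// EFinM.
rewrite poweRM ?lee_fin ?powR_ge0 ?lp_sum_ge0//.
by rewrite poweR_EFin -powRrM mulfV// powRr1 ?rnormS_ge0.
Qed.

Lemma lp_norm_triangle x y :
  (lp_norm p (fun n => x n + y n)%R <= lp_norm p x + lp_norm p y)%E.
Proof.
have mf (f : nat -> R) : measurable_fun [set: nat] f by [].
have := minkowski_EFin counting (mf (fun n => rnorm (x n)))
  (mf (fun n => rnorm (y n))) p1.
rewrite -!lp_normE; apply: le_trans.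
rewrite Lnorm_counting// gt0_ler_poweR ?invr_ge0 ?(ltW p_gt0)//.
- by rewrite in_itv /= leey andbT lp_sum_ge0.
- rewrite in_itv /= leey andbT; apply: nneseries_ge0 => n _ _.
  by rewrite /= lee_fin powR_ge0.
apply: lee_nneseries => [n _|n _]; first by rewrite lee_fin powR_ge0.
have p_ge0 := ltW p_gt0.
rewrite /= lee_fin; apply: ge0_ler_powR; rewrite ?nnegrE ?rnormS_ge0//.
exact: le_trans (rnormSD _ _) (ler_norm _).
Qed.

Lemma lp_norm_eq0 x : lp_norm p x = 0%E -> x = 0.
Proof.
move=> /(poweR_eq0_eq0 (lp_sum_ge0 x)) x0; apply/funext => n.
apply: rnormS_eq0; apply: (@powR_eq0_eq0 _ _ p).
apply/eqP; rewrite eq_le powR_ge0 andbT.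
suff : ((rnorm (x n) `^ p)%:E <= lp_sum p x)%E by rewrite x0 lee_fin.
rewrite /lp_sum (nneseries_split 0 n.+1); last first.
  by move=> i _; rewrite lee_fin powR_ge0.
rewrite add0n big_nat_recr//= -addeA addeCA leeDl// adde_ge0//.
  by apply: sume_ge0 => i _; rewrite lee_fin powR_ge0.
by apply: nneseries_ge0 => i _ _; rewrite lee_fin powR_ge0.
Qed.

Lemma lp_pred_submod : submod_closed (lp_pred p).
Proof.
split=> [|a x y].
  rewrite -lp_norm_lty [X in lp_norm p X](_ : _ = fun n => 0 * (0 : K)).
    by rewrite (lp_normZ 0 (fun=> 0)) rnormS0 mul0e.
  by apply/funext => n; rewrite mul0r.
rewrite -!lp_norm_lty => xoo yoo.
apply: le_lt_trans (lp_norm_triangle (fun n => a * x n) y) _.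
rewrite lte_add_pinfty// lp_normZ lte_mul_pinfty// ?lee_fin ?rnormS_ge0//.
Qed.

Lemma lp_pred_delta n : (fun i => (i == n)%:R : K) \in lp_pred p.
Proof.
apply/lp_predP; rewrite /lp_sum (nneseries_split 0 n.+1); last first.
  by move=> i _; rewrite lee_fin powR_ge0.
rewrite add0n eseries0 ?adde0.
  by rewrite sumEFin ltry.
move=> i ni _ ; rewrite gtn_eqF ?rnormS0 ?powR0//.
Qed.

End Theory.
End LpSequences.

Section Ell.
Context (R : realType) (k : scalar_kind).
Local Notation K := (scalars R k).

Record ell (p : R) (p1 : 1 <= p) := Ell {
  ell_seq :> nat -> K;
  ell_seqP : ell_seq \in lp_pred p }.

Section Instances.
Variables (p : R) (p1 : 1 <= p).

HB.instance Definition _ := GRing.isSubmodClosed.Build K (nat -> K)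
  (lp_pred p) (lp_pred_submod k p1).
HB.instance Definition _ := [isSub for @ell_seq p p1].
HB.instance Definition _ := [Choice of ell p1 by <:].
HB.instance Definition _ := [SubChoice_isSubLmodule of ell p1 by <:].

Definition ell_norm (x : ell p1) : K := ofR k (fine (lp_norm p x)).

Lemma lp_norm_fin_num (x : ell p1) : lp_norm p x \is a fin_num.
Proof. by rewrite ge0_fin_numE ?lp_norm_ge0// lp_norm_lty// ell_seqP. Qed.

Lemma ell_normD x y : ell_norm (x + y) <= ell_norm x + ell_norm y.
Proof.
rewrite /ell_norm -ofRD ler_ofR -fineD ?lp_norm_fin_num//.
rewrite fine_le ?fin_numD ?lp_norm_fin_num//.
exact: lp_norm_triangle.
Qed.

Lemma ell_normZ (a : K) x : ell_norm (a *: x) = `|a| * ell_norm x.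
Proof.
rewrite /ell_norm -(ofR_rnormS a) -ofRM; congr (ofR k _).
have -> : lp_norm p (a *: x) = ((rnorm a)%:E * lp_norm p x)%E.
  exact: lp_normZ.
by rewrite fineM ?lp_norm_fin_num.
Qed.

Lemma ell_norm_eq0 x : ell_norm x = 0 -> x = 0.
Proof.
move=> /(congr1 (@reS R k)); rewrite reS_ofR -(ofR0 R k) reS_ofR => x0.
apply/val_inj; rewrite raddf0; apply: (@lp_norm_eq0 R k p).
by rewrite -[LHS]fineK ?lp_norm_fin_num// x0.
Qed.

HB.instance Definition _ := Lmodule_isNormed.Build K (ell p1)
  ell_normD ell_normZ ell_norm_eq0.

Definition ell_delta (n : nat) : ell p1 := Ell p1 (lp_pred_delta k p1 n).

End Instances.
End Ell.

Section Completeness.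
Context (R : realType).

Lemma complex_cauchy_cvg (F : set_system (scalars R ComplexScalars)) :
  ProperFilter F -> cauchy F -> cvg F.
Proof.
move=> FF /cauchyP F_cauchy.
have part (f : R[i] -> R) (fB : forall x y, `|f x - f y|%:C%C <= `|x - y|) :
    exists l : R, f @ F --> l.
  have fFF : ProperFilter (f @ F) by exact: fmap_proper_filter.
  apply/cvg_ex; apply: (@cauchy_cvg R^o (f @ F) fFF); apply: cauchy_exP => e e0.
  have [|z zF] := F_cauchy e%:C%C; first by rewrite ltcR.
  exists (f z); change (F (f @^-1` ball (f z : R^o) e)).
  apply: filterS zF => y; rewrite -!ball_normE /= => zy; rewrite -ltcR.
  exact: le_lt_trans (fB _ _) zy.
have [x y|a aF] := part (@complex.Re R).
  by rewrite -raddfB normc_ge_Re.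
have [x y|b bF] := part (@complex.Im R).
  rewrite -raddfB; case: (x - y) => c d /=.
  rewrite normc_def lecR /= -sqrtr_sqr ler_sqrt ?lerDr ?sqr_ge0//.
  by rewrite addr_ge0 ?sqr_ge0.
apply/cvg_ex; exists (Complex a b).
apply/cvgrPdist_lt => e e0.
have ere : e = (complex.Re e)%:C%C by case: e e0 => x y; rewrite ltcE /= => /andP[/eqP -> _].
have er0 : 0 < complex.Re e by rewrite -ltcR -ere.
have e20 : 0 < complex.Re e / 2 by rewrite divr_gt0.
move/cvgrPdist_lt/(_ _ e20) : aF => aF.
move/cvgrPdist_lt/(_ _ e20) : bF => bF.
have dec (w : R[i]) : Complex a b - w =
    (a - complex.Re w)%:C%C + 'i%C * (b - complex.Im w)%:C%C.
  case: w => c d; apply/eqP; rewrite eq_complex /=.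
  by apply/andP; split; apply/eqP; ring.
near=> z.
have az : `|a - complex.Re z| < complex.Re e / 2 by near: z.
have bz : `|b - complex.Im z| < complex.Re e / 2 by near: z.
rewrite ere dec.
apply: le_lt_trans (ler_normD _ _) _.
rewrite normrM !normc_def /= expr0n /= !addr0 add0r !sqrtr_sqr normr1 mul1r.
by rewrite (splitr (complex.Re e)) rmorphD/= ltrD// ltcR.
Unshelve. all: by end_near.
Qed.

Variable k : scalar_kind.
Local Notation K := (scalars R k).

Lemma scalars_cauchy_cvg (F : set_system K) :
  ProperFilter F -> cauchy F -> cvg F.
Proof.
move: F; rewrite /K; case: k => F FF Fc; last exact: complex_cauchy_cvg.
exact: (@cauchy_cvg R^o F FF Fc).
Qed.

Variables (p : R) (p1 : 1 <= p).
Local Notation E := (ell k p1).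

Let p_gt0 : 0 < p. Proof. exact: lt_le_trans ltr01 p1. Qed.
Let p_neq0 : p != 0. Proof. by rewrite gt_eqF. Qed.

Lemma ell_rnormE (x : E) : (rnorm x)%:E = lp_norm p x.
Proof.
by rewrite /Num.norm /= /ell_norm reS_ofR fineK// lp_norm_fin_num.
Qed.

Lemma lp_sum_rnorm (x : E) : lp_sum p x = (rnorm x `^ p)%:E.
Proof.
rewrite -poweR_EFin ell_rnormE /lp_norm -poweRrM mulVf// poweRe1//.
exact: lp_sum_ge0.
Qed.

Lemma lp_sum_ge_partial (x : nat -> K) N :
  ((\sum_(i < N) rnorm (x i) `^ p)%R%:E <= lp_sum p x)%E.
Proof.
rewrite /lp_sum (nneseries_split 0 N); last first.
  by move=> i _; rewrite lee_fin powR_ge0.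
rewrite add0n big_mkord sumEFin leeDl//.
by apply: nneseries_ge0 => i _ _; rewrite lee_fin powR_ge0.
Qed.

Lemma ell_coord_le (x : E) n : `|x n| <= `|x|.
Proof.
rewrite -(ofR_rnorm x) -ofR_rnormS ler_ofR.
have := lp_sum_ge_partial x n.+1.
rewrite lp_sum_rnorm lee_fin big_ord_recr/= => xn.
have : rnorm (x n) `^ p <= rnorm x `^ p.
  by apply: le_trans xn; rewrite lerDr sumr_ge0// => i _; rewrite powR_ge0.
apply: contraTT; rewrite -!ltNge => h.
rewrite gt0_ltr_powR// nnegrE ?rnormS_ge0//.
by rewrite -lee_fin ell_rnormE lp_norm_ge0.
Qed.

Lemma ellZE (a : K) (x : E) n : (a *: x) n = a * x n.
Proof. by []. Qed.

Lemma ell_deltaE i n : ell_delta k p1 i n = (n == i)%:R.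
Proof. by []. Qed.

Definition ell_trunc N (x : nat -> K) : E :=
  \sum_(i < N) x i *: ell_delta k p1 i.

Lemma ell_truncE N (x : nat -> K) n :
  ell_trunc N x n = if (n < N)%N then x n else 0.
Proof.
have -> : ell_seq (ell_trunc N x) = \sum_(i < N) ell_seq (x i *: ell_delta k p1 i).
  exact: (raddf_sum val).
rewrite fct_sumE.
under eq_bigr => i _ do rewrite ellZE ell_deltaE.
case: ltnP => nN.
  rewrite (bigD1 (Ordinal nN))//= eqxx mulr1 big1 ?addr0// => i.
  by rewrite -val_eqE /= eq_sym => /negPf ->; rewrite mulr0.
rewrite big1// => i _; rewrite gtn_eqF ?mulr0//.
exact: leq_trans nN.
Qed.

Lemma ell_norm_le (x y : E) :
  (forall n, `|x n| <= `|y n|) -> `|x| <= `|y|.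
Proof.
move=> xy; have p_ge0 := ltW p_gt0.
rewrite -(ofR_rnorm x) -(ofR_rnorm y) ler_ofR -lee_fin !ell_rnormE.
rewrite gt0_ler_poweR ?invr_ge0// ?in_itv/= ?leey ?lp_sum_ge0//.
apply: lee_nneseries => [n _|n _]; first by rewrite lee_fin powR_ge0.
rewrite lee_fin; apply: ge0_ler_powR; rewrite ?nnegrE ?rnormS_ge0//.
by rewrite -(ler_ofR k) !ofR_rnormS.
Qed.

Lemma ell_delta_norm n : `|ell_delta k p1 n| = 1.
Proof.
have -> : 1 = ofR k 1 by case: k.
rewrite -(ofR_rnorm (ell_delta k p1 n)); congr (ofR k _); apply/eqP.
rewrite -(@eqe R) ell_rnormE /lp_norm /lp_sum (nneseries_split 0 n.+1); last first.
  by move=> i _; rewrite lee_fin powR_ge0.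
have rnorm1 : rnorm (1 : K) = 1.
  by rewrite normr1; case: k.
rewrite add0n eseries0 ?adde0; last first.
  by move=> i ni _; rewrite /= gtn_eqF ?rnormS0 ?powR0.
rewrite big_nat_recr//= big_nat big1 ?add0e => [|i /andP[_ ni]].
  by rewrite eqxx rnorm1 powR1 poweR1r.
by rewrite ltn_eqF ?rnormS0 ?powR0.
Qed.

Lemma ell_trunc_norm N (x : nat -> K) :
  `|ell_trunc N x| <= \sum_(i < N) `|x i|.
Proof.
apply: le_trans (ler_norm_sum _ _ _) _.
by apply: ler_sum => i _; rewrite normrZ ell_delta_norm mulr1.
Qed.

Lemma ell_trunc_le N (x : E) : `|ell_trunc N x| <= `|x|.
Proof.
by apply: ell_norm_le => n; rewrite ell_truncE; case: ifP; rewrite ?normr0.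
Qed.

Lemma ell_truncB N (x y : nat -> K) :
  ell_trunc N (x - y) = ell_trunc N x - ell_trunc N y.
Proof.
rewrite /ell_trunc -sumrB; apply: eq_bigr => i _.
by rewrite -scalerBl.
Qed.

Lemma ell_trunc_bound (x : nat -> K) (c : R) : 0 <= c ->
  (forall N, `|ell_trunc N x| <= ofR k c) -> (lp_norm p x <= c%:E)%E.
Proof.
move=> c0 xc; have p_ge0 := ltW p_gt0.
have -> : c%:E = ((c `^ p)%:E `^ p^-1)%E.
  by rewrite poweR_EFin -powRrM mulfV// powRr1.
rewrite gt0_ler_poweR ?invr_ge0// ?in_itv/= ?leey ?lp_sum_ge0 ?lee_fin ?powR_ge0//.
apply: lime_le.
  by apply: is_cvg_nneseries => n _ _; rewrite lee_fin powR_ge0.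
apply: nearW => N.
rewrite big_mkord sumEFin.
have -> : \sum_(i < N) rnorm (x i) `^ p =
    \sum_(i < N) rnorm (ell_trunc N x i) `^ p.
  by apply: eq_bigr => i _; rewrite ell_truncE ltn_ord.
apply: le_trans (lp_sum_ge_partial _ _) _.
rewrite lp_sum_rnorm lee_fin; apply: ge0_ler_powR; rewrite ?nnegrE//.
  by rewrite -lee_fin ell_rnormE lp_norm_ge0.
by rewrite -(ler_ofR k) ofR_rnorm.
Qed.

Lemma ell_cauchy_cvg (F : set_system E) :
  ProperFilter F -> cauchy F -> cvg F.
Proof.
move=> FF /cauchyP Fc.
have coord n : exists l : K, (fun x : E => x n) @ F --> l.
  apply/cvg_ex; apply: scalars_cauchy_cvg; apply: cauchy_exP => e e0.
  have [x xF] := Fc e e0.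
  exists (x n); change (F ((fun x : E => x n) @^-1` ball (x n) e)).
  apply: filterS xF => y; rewrite -!ball_normE /=.
  exact/le_lt_trans/(ell_coord_le (x - y)).
have [l Fl] : exists l : nat -> K, forall n, (fun x : E => x n) @ F --> l n.
  by have [l] := choice coord; exists l.
have near_l (e : K) (x : E) : 0 < e -> F (ball x e) ->
    (lp_norm p (ell_seq x - l)%R <= (reS e + reS e)%:E)%E.
  move=> e0 xF.
  have ofe : ofR k (reS e) = e by exact/ofR_reS/ltW.
  have re0 : 0 <= reS e by rewrite -(ofR_ge0 k) ofe ltW.
  apply: ell_trunc_bound => [|N]; first by rewrite addr_ge0.
  rewrite ofRD ofe.
  have : \forall y \near F, forall i : 'I_N, `|l i - (y : E) i| < e / (N.+1)%:R.
    apply: filter_forall => i.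
    by move/cvgrPdist_lt: (Fl i); apply; rewrite divr_gt0.
  move=> /(filterI xF) /filter_ex [y [xy ly]].
  have -> : ell_seq x - l = ell_seq (x - y) - (l - ell_seq y).
    by rewrite opprB addrA; congr (_ - l); rewrite -[ell_seq (x - y)]/(ell_seq x - ell_seq y) subrK.
  rewrite ell_truncB; apply: le_trans (ler_normB _ _) _; apply: lerD.
    apply: le_trans (ell_trunc_le _ _) _.
    by move: xy; rewrite -ball_normE /=; exact: ltW.
  apply: le_trans (ell_trunc_norm _ _) _.
  apply: (@le_trans _ _ (\sum_(i < N) e / N.+1%:R)).
    by apply: ler_sum => i _; exact/ltW/ly.
  rewrite sumr_const card_ord -mulrnAr -[leRHS]mulr1 ler_wpM2l ?(ltW e0)//.
  by rewrite -[_ *+ N]mulr_natl ler_pdivrMr// mul1r ler_nat.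
have lE : l \in lp_pred p.
  have [x xF] := Fc 1 ltr01.
  have -> : l = ell_seq x - (ell_seq x - l) by rewrite opprB addrC subrK.
  apply: rpredB; first exact: ell_seqP.
  rewrite -(lp_norm_lty p1).
  by apply: le_lt_trans (near_l _ _ ltr01 xF) _; rewrite ltry.
apply/cvg_ex; exists (Ell p1 lE).
apply/cvgrPdist_lt => e e0.
have e40 : 0 < e / 4 by rewrite divr_gt0.
have [x xF] := Fc _ e40.
have xl : `|x - Ell p1 lE| <= e / 4 + e / 4.
  have := near_l _ _ e40 xF.
  rewrite -[ell_seq x - l]/(ell_seq (x - Ell p1 lE)) -ell_rnormE lee_fin.
  by rewrite -(ler_ofR k) ofRD ofR_rnorm ofR_reS ?(ltW e40).
apply: filterS xF => y; rewrite -ball_normE /= => xy.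
rewrite -(subrKA x) [e](_ : _ = (e / 4 + e / 4) + (e / 4 + e / 4)); last by field.
apply: le_lt_trans (ler_normD _ _) _; rewrite distrC ler_ltD//.
by apply: lt_le_trans xy _; rewrite lerDl ltW.
Qed.

HB.instance Definition _ := Uniform_isComplete.Build E ell_cauchy_cvg.

End Completeness.

Section Ell12.
Context (R : realType) (k : scalar_kind).
Local Notation K := (scalars R k).

Lemma le12 : 1 <= 2 :> R. Proof. by rewrite ler1n. Qed.

Definition ell1 := ell k (lexx (1 : R)).
Definition ell2 := ell k le12.

Lemma lp_pred12 (x : nat -> K) : x \in lp_pred 1 -> x \in lp_pred 2.
Proof.
move=> /lp_predP; rewrite /lp_sum.
under eq_eseriesr do rewrite powRr1 ?rnormS_ge0//.
set S := (\sum_(_ <= _ <oo) _)%E => Soo.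
have S0 : (0 <= S)%E.
  by apply: nneseries_ge0 => n _ _; rewrite lee_fin rnormS_ge0.
have xS n : ((rnorm (x n))%:E <= S)%E.
  rewrite /S (nneseries_split 0 n.+1); last first.
    by move=> i _; rewrite lee_fin rnormS_ge0.
  rewrite add0n big_nat_recr//= -addeA addeCA leeDl// adde_ge0//.
    by apply: sume_ge0 => i _; rewrite lee_fin rnormS_ge0.
  by apply: nneseries_ge0 => i _ _; rewrite lee_fin rnormS_ge0.
apply/lp_predP; apply: (@le_lt_trans _ _ (S * S)%E); last first.
  by rewrite lte_mul_pinfty// ge0_fin_numE.
have Sfin : S \is a fin_num by rewrite ge0_fin_numE.
rewrite /lp_sum -{1}(fineK Sfin) {2}/S -nneseriesZl//; last first.
  by move=> n _; rewrite lee_fin rnormS_ge0.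
rewrite fineK//; apply: lee_nneseries => [n _|n _]; first by rewrite lee_fin powR_ge0.
by rewrite powR_mulrn ?rnormS_ge0// expr2 EFinM lee_wpmul2r ?lee_fin ?rnormS_ge0.
Qed.

Definition ell12 (x : ell1) : ell2 := Ell le12 (lp_pred12 (ell_seqP x)).

(* linear in the first variable, as in x x^* : v |-> <v, x> x *)
Definition dot (x y : ell2) : K :=
  limn (series (fun n => x n * conjS (y n))).

Definition delta (n : nat) : ell2 := ell_delta k le12 n.

End Ell12.

Record inner_product (R : realType) (k : scalar_kind)
    (H : normedModType (scalars R k)) := InnerProduct {
  ip_fun :> H -> H -> scalars R k;
  ip_linear : forall (a : scalars R k) (x y z : H),
    ip_fun (a *: x + y) z = a * ip_fun x z + ip_fun y z;
  ip_conj : forall x y : H, ip_fun y x = conjS (ip_fun x y);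
  ip_norm : forall x : H, ip_fun x x = `|x| ^+ 2 }.

Section Operators.
Context (R : realType) (k : scalar_kind).
Local Notation K := (scalars R k).
Local Notation ell1 := (ell1 R k).
Local Notation ell2 := (ell2 R k).

Definition bounded_operator (X Y : normedModType K) (T : X -> Y) :=
  exists M : R, forall x : X, rnorm (T x) <= M * rnorm x.

Definition self_adjoint (A : ell2 -> ell2) :=
  forall x y : ell2, dot (A x) y = dot x (A y).

(* [0 <= z] in the complex case says that z is real and nonnegative *)
Definition positive (A : ell2 -> ell2) := forall x : ell2, 0 <= dot (A x) x.

Definition bounded_psd (A : ell2 -> ell2) :=
  [/\ bounded_operator A, self_adjoint A & positive A].

(* the unique positive square root of a [bounded_psd] operator; junk otherwise *)
Definition sqrt_op (A : {linear ell2 -> ell2}) : {linear ell2 -> ell2} :=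
  xget (A : {classic {linear ell2 -> ell2}})
    [set S : {linear ell2 -> ell2} |
      bounded_psd S /\ forall x, S (S x) = A x].

Definition norm11 (A : ell2 -> ell2) : \bar R :=
  (\esum_(ij in [set: nat * nat])
     (rnorm (dot (A (delta R k ij.1)) (delta R k ij.2)))%:E)%E.

Definition Gamma (A : {linear ell2 -> ell2}) :=
  bounded_psd A /\ (norm11 A < +oo)%E.

Definition rank_one (x v : ell2) : ell2 := dot v x *: x.

Definition strong_decomposition (A : ell2 -> ell2) (x : nat -> ell1) :=
  forall v : ell2,
    (fun n => \sum_(i < n) rank_one (ell12 (x i)) v) @ \oo --> A v.

Definition gamma_plus (A : ell2 -> ell2) : \bar R :=
  ereal_inf [set (\sum_(0 <= n <oo) (rnorm (x n) ^+ 2)%:E)%E |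
              x in strong_decomposition A].

Definition Gamma_plus (A : {linear ell2 -> ell2}) :=
  Gamma A /\ (gamma_plus A < +oo)%E.

Definition dual_ball (X : normedModType K) : set {linear X -> K^o} :=
  [set f : {linear X -> K^o} | forall x, `|f x| <= `|x|].

Definition two_summing_const (X Y : completeNormedModType K)
    (T : {linear X -> Y}) (C : R) :=
  0 <= C /\
  forall (N : nat) (x : 'I_N -> X),
    ((\sum_(i < N) rnorm (T (x i)) ^+ 2)%:E <=
     (C ^+ 2)%:E * ereal_sup [set (\sum_(i < N) rnorm (f (x i)) ^+ 2)%:E |
                               f in @dual_ball X])%E.

Definition two_summing (X Y : completeNormedModType K) (T : {linear X -> Y}) :=
  exists C : R, two_summing_const T C.

Definition pi2 (X Y : completeNormedModType K) (T : {linear X -> Y}) : \bar R :=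
  ereal_inf [set C%:E | C in two_summing_const T].

Definition bilinear_sup (n : nat) (a : 'M[K]_n) : \bar R :=
  ereal_sup [set (rnorm (\sum_i \sum_j a i j * st.1 i * st.2 j))%:E |
    st in [set st : ('I_n -> K) * ('I_n -> K) |
            (forall i, `|st.1 i| <= 1) /\ (forall j, `|st.2 j| <= 1)]].

Definition grothendieck_bound (c : R) :=
  forall (n : nat) (a : 'M[K]_n) (H : completeNormedModType K)
      (ip : inner_product H) (u v : 'I_n -> H),
    (forall i, `|u i| = 1) -> (forall j, `|v j| = 1) ->
    ((rnorm (\sum_i \sum_j a i j * ip (u i) (v j))%R)%:E <=
     c%:E * bilinear_sup a)%E.

(* an infimum in [\bar R], so finiteness (Grothendieck's inequality) is not
   built into the definition *)
Definition kappa_G : \bar R := ereal_inf [set c%:E | c in grothendieck_bound].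

End Operators.

(* Main.v *)
Require Import Defs.
From HB Require Import structures.
From mathcomp Require Import all_boot all_order all_algebra.
From mathcomp Require Import complex.
From mathcomp Require Import all_classical all_reals all_analysis.
From mathcomp Require Import ring lra.

(* Write [S] for the square root of [A] and [w_n] for the norm of [S delta_n];
   then [D] is the sum of the [w_n].

   (A) The n-th coordinate of [S x] is [<x, S delta_n>], so [S] maps l2 into l1,
   and Minkowski's inequality in [R^N], with the functionals [<., S delta_n> / w_n]
   of norm one as tests, gives 2-summing constant [D].  For any 2-summing constant
   [C] of [S], [A v = S (S v)] is the sum of the [<v, S delta_n> S delta_n], and
   testing on the basis gives [sum |S delta_n|_1^2 <= C^2].

   (B) Let [e] range over the sign vectors in [{-1, 1}^M], acting on l2 by
   coordinatewise multiplication.  Grothendieck's inequality is applied to the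
   vectors [delta_i] and [e . conj (S delta_n) / w_n], indexed by [i] and by the
   pairs [(e, n)], and to the matrix [2^-M e_i (S delta_i)_n].  The left-hand side is
   then [sum_n sum_(i < M) |(S delta_n)_i|^2 / w_n], independently of the signs.  On
   scalars, the bilinear form is at most the average over [e] of the l1 norm of
   [S (sum_i e_i s_i delta_i)], which is at most [C] by Cauchy-Schwarz and the
   2-summing inequality, because random signs are orthogonal. *)

Set Implicit Arguments.
Unset Strict Implicit.
Unset Printing Implicit Defensive.
Import Order.TTheory GRing.Theory Num.Theory.
Import numFieldNormedType.Exports.
Local Open Scope classical_set_scope.
Local Open Scope ring_scope.

(** * Scalars and norms *)

Lemma cvg_eqfun (T : Type) (U : nbhsType) (F : set_system T) (f g : T -> U) (l : U) :
  f =1 g -> f @ F --> l -> g @ F --> l.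
Proof. by move=> /funext ->. Qed.

Section ScalarTheory.
Context (R : realType) (k : scalar_kind).
Local Notation K := (scalars R k).
Local Notation conjS := (@conjS R k).
Local Notation ofR := (@ofR R k).

Lemma conjS_is_zmod_morphism : zmod_morphism conjS.
Proof. by rewrite /conjS; case: k => //= x y; rewrite raddfB. Qed.

Lemma conjS_is_monoid_morphism : monoid_morphism conjS.
Proof. by rewrite /conjS; case: k => //=; split=> [|x y]; rewrite ?rmorph1 ?rmorphM. Qed.

HB.instance Definition _ := GRing.isZmodMorphism.Build K K conjS
  conjS_is_zmod_morphism.
HB.instance Definition _ := GRing.isMonoidMorphism.Build K K conjS
  conjS_is_monoid_morphism.

Lemma conjSK : involutive conjS.
Proof. by rewrite /conjS; case: k => //= x; rewrite conjcK. Qed.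

Lemma norm_conjS (x : K) : `|conjS x| = `|x|.
Proof.
move: x; rewrite /conjS; case: k => //= -[a b].
by rewrite !normc_def /= sqrrN.
Qed.

Lemma mul_conjS (x : K) : x * conjS x = `|x| ^+ 2.
Proof.
move: x; rewrite /conjS; case: k => [x|x]; first by rewrite real_normK ?num_real// expr2.
by rewrite sqr_normc.
Qed.

Lemma conjS_ofR (x : R) : conjS (ofR x) = ofR x.
Proof. by rewrite /conjS /ofR; case: k; rewrite //= oppr0. Qed.

Lemma ofR_is_zmod_morphism : zmod_morphism ofR.
Proof. by rewrite /ofR; case: k => // x y; apply/eqP; rewrite eq_complex /= subr0 !eqxx. Qed.

Lemma ofR_is_monoid_morphism : monoid_morphism ofR.
Proof. by split=> [|x y]; [case: k | rewrite ofRM]. Qed.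

HB.instance Definition _ := GRing.isZmodMorphism.Build R K ofR
  ofR_is_zmod_morphism.
HB.instance Definition _ := GRing.isMonoidMorphism.Build R K ofR
  ofR_is_monoid_morphism.

Lemma reS_is_zmod_morphism : zmod_morphism (@reS R k).
Proof. by rewrite /reS; case: k => // -[? ?] [? ?]. Qed.

HB.instance Definition _ := GRing.isZmodMorphism.Build K R (@reS R k)
  reS_is_zmod_morphism.

Lemma ltr_ofR (x y : R) : (ofR x < ofR y) = (x < y).
Proof. by rewrite !lt_neqAle ler_ofR (inj_eq (fmorph_inj ofR)). Qed.

Lemma norm_ofR (x : R) : `|ofR x| = ofR `|x|.
Proof.
case: k => //=.
by rewrite normc_def /= expr0n /= addr0 sqrtr_sqr.
Qed.

Lemma rnorm_ofR (x : R) : 0 <= x -> rnorm (ofR x) = x.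
Proof. by move=> x0; rewrite norm_ofR ger0_norm// reS_ofR. Qed.

Lemma rnorm_conjS (x : K) : rnorm (conjS x) = rnorm x.
Proof. by rewrite norm_conjS. Qed.

Lemma reS_ge0 (x : K) : 0 <= x -> 0 <= reS x.
Proof. by move=> x0; rewrite -(ofR_ge0 k) ofR_reS. Qed.

Lemma ler_reS (x y : K) : 0 <= x -> x <= y -> reS x <= reS y.
Proof.
move=> x0 xy; rewrite -(ler_ofR k) !ofR_reS//.
exact: le_trans xy.
Qed.

Lemma conjS_fixed (z : K) : conjS z = z -> z = ofR (reS z).
Proof.
move: z; rewrite /conjS /ofR /reS; case: k => //= -[a b] /eqP.
rewrite eq_complex /= => /andP[_]; rewrite eq_sym -subr_eq0 opprK -mulr2n.
by rewrite mulrn_eq0 /= => /eqP ->.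
Qed.

Lemma reS_le_rnorm (z : K) : reS z <= rnorm z.
Proof.
move: z; rewrite /reS; case: k => [r|[a b]]; first exact: ler_norm.
rewrite normc_def /=; apply: le_trans (ler_norm _) _.
by rewrite -sqrtr_sqr ler_sqrt ?lerDl ?addr_ge0 ?sqr_ge0.
Qed.

Section Norm.
Variable V : normedModType K.
Implicit Types x y : V.

Lemma rnorm_ge0 x : 0 <= rnorm x.
Proof. exact/reS_ge0/normr_ge0. Qed.

Lemma rnormD x y : rnorm (x + y) <= rnorm x + rnorm y.
Proof. by rewrite -(ler_ofR k) ofRD !ofR_rnorm ler_normD. Qed.

Lemma rnormB x y : rnorm (x - y) <= rnorm x + rnorm y.
Proof. by rewrite -(ler_ofR k) ofRD !ofR_rnorm ler_normB. Qed.

Lemma rnormZ (a : K) x : rnorm (a *: x) = rnorm a * rnorm x.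
Proof. by rewrite normrZ -(ofR_rnormS a) -(ofR_rnorm x) -ofRM !reS_ofR. Qed.

Lemma rnorm_le (W : normedModType K) x (z : W) :
  rnorm x <= rnorm z -> `|x| <= `|z|.
Proof. by move=> xz; rewrite -(ofR_rnorm x) -(ofR_rnorm z) ler_ofR. Qed.

Lemma rnorm0 : rnorm (0 : V) = 0.
Proof. by rewrite normr0 raddf0. Qed.

Lemma rnorm0_eq0 x : rnorm x = 0 -> x = 0.
Proof. by move=> x0; apply: normr0_eq0; rewrite -ofR_rnorm x0 raddf0. Qed.

(** The radii of balls are elements of the scalar field; a positive one is [ofR] of its real part,
    which reduces convergence to that of a real-valued function. *)
Lemma cvg_rnorm (T : Type) (F : set_system T) {FF : Filter F} (u : T -> V) (l : V) :
  (fun n => rnorm (l - u n)) @ F --> (0 : R) -> u @ F --> l.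
Proof.
move=> ul; apply/cvgrPdist_lt => e e0.
have re0 : 0 < reS e by rewrite -(ltr_ofR) raddf0 ofR_reS// ltW.
move/cvgrPdist_lt/(_ _ re0) : ul; apply: filterS => n.
rewrite sub0r normrN ger0_norm ?rnorm_ge0// -ltr_ofR ofR_rnorm ofR_reS//.
exact: ltW.
Qed.

Lemma rnorm_cvg (T : Type) (F : set_system T) {FF : Filter F} (u : T -> V) (l : V) :
  u @ F --> l -> (fun n => rnorm (l - u n)) @ F --> (0 : R).
Proof.
move=> ul; apply/cvgrPdist_lt => e e0.
have re0 : 0 < ofR e by rewrite -(raddf0 ofR) ltr_ofR.
move/cvgrPdist_lt/(_ _ re0) : ul; apply: filterS => n.
by rewrite sub0r normrN ger0_norm ?rnorm_ge0// -ofR_rnorm ltr_ofR reS_ofR.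
Qed.

Lemma cvg_of_rnorm (T : Type) (F : set_system T) {FF : Filter F} (u : T -> V) (l : V) :
  u @ F --> l -> (fun n => rnorm (u n)) @ F --> rnorm l.
Proof.
move=> /rnorm_cvg ul; apply/cvgrPdist_lt => e e0.
move/cvgrPdist_lt/(_ _ e0) : ul; apply: filterS => n.
rewrite sub0r normrN ger0_norm ?rnorm_ge0//; apply: le_lt_trans.
have tri a b : rnorm a - rnorm b <= rnorm (a - b :> V).
  by rewrite lerBlDl; apply: le_trans (rnormD _ _); rewrite subrKC.
by rewrite ler_norml tri lerNl opprB distrC tri.
Qed.

(** Completeness enters as a hypothesis on filters, so that the criterion applies both to the scalar
    field and to l2. *)
Lemma cauchy_rnorm_cvg (Vc : forall F : set_system V, ProperFilter F -> cauchy F -> cvg F)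
    (u : nat -> V) :
  (forall e : R, 0 < e -> exists N, forall n, (N <= n)%N -> rnorm (u n - u N) < e) ->
  cvg (u @ \oo).
Proof.
move=> uc; apply: Vc; apply: cauchy_exP => e e0.
have re0 : 0 < reS e by rewrite -(ltr_ofR) raddf0 ofR_reS// ltW.
have [N NP] := uc _ re0; exists (u N).
exists N => // n /= /NP.
rewrite -ball_normE/= -ltr_ofR ofR_rnorm ofR_reS ?(ltW e0)//.
by rewrite distrC.
Qed.

End Norm.

End ScalarTheory.

(** * Real series with nonnegative terms *)

Lemma nneseries_cvg (R : realType) (a : nat -> R) (l : R) :
  (forall n, 0 <= a n) -> (\sum_(0 <= n <oo) (a n)%:E)%E = l%:E ->
  (fun n => \sum_(i < n) a i) @ \oo --> l.
Proof.
move=> a0 al.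
have : (fun n => (\sum_(0 <= i < n) (a i)%:E)%E) @ \oo --> l%:E.
  by rewrite -al; apply: is_cvg_nneseries => n _ _; rewrite lee_fin.
move=> /fine_cvgP[_]; apply: cvg_eqfun => n.
by rewrite /= big_mkord sumEFin.
Qed.

Lemma nneseries_le (R : realType) (a : nat -> R) (c : \bar R) :
  (forall n, 0 <= a n) -> (forall n, (\sum_(i < n) a i)%:E <= c)%E ->
  (\sum_(0 <= n <oo) (a n)%:E <= c)%E.
Proof.
move=> a0 ac; apply: lime_le.
  by apply: is_cvg_nneseries => n _ _; rewrite lee_fin.
by apply: nearW => n; rewrite big_mkord sumEFin.
Qed.

Lemma nneseries_ge (R : realType) (a : nat -> R) n :
  (forall n, 0 <= a n) ->
  ((\sum_(i < n) a i)%:E <= \sum_(0 <= n <oo) (a n)%:E)%E.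
Proof.
move=> a0; rewrite -sumEFin -(big_mkord xpredT (fun i => (a i)%:E)).
by apply: nneseries_lim_ge => i _ _; rewrite lee_fin.
Qed.

(** * Norms of l1 and l2 and the inner product as limits of partial sums *)

Section Ell12Theory.
Context (R : realType) (k : scalar_kind).
Local Notation K := (scalars R k).
Local Notation ell1 := (ell1 R k).
Local Notation ell2 := (ell2 R k).
Local Notation conjS := (@conjS R k).
Local Notation ofR := (@ofR R k).
Local Notation delta := (delta R k).

Lemma ell2_cvg (x : ell2) :
  (fun n => \sum_(i < n) rnorm (x i) ^+ 2) @ \oo --> rnorm x ^+ 2.
Proof.
apply: (@nneseries_cvg _ (fun n => rnorm (x n) ^+ 2)) => [n|]; first exact: sqr_ge0.
transitivity (lp_sum 2 x); last by rewrite lp_sum_rnorm powR_mulrn ?rnorm_ge0.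
by apply: eq_eseriesr => n _; rewrite powR_mulrn ?rnormS_ge0.
Qed.

Lemma ell2_partial (x : ell2) n : \sum_(i < n) rnorm (x i) ^+ 2 <= rnorm x ^+ 2.
Proof.
have := lp_sum_ge_partial 2 x n; rewrite lp_sum_rnorm lee_fin powR_mulrn ?rnorm_ge0//.
by under eq_bigr do rewrite powR_mulrn ?rnormS_ge0//.
Qed.

Lemma ell1_cvg (x : ell1) :
  (fun n => \sum_(i < n) rnorm (x i)) @ \oo --> rnorm x.
Proof.
apply: (@nneseries_cvg _ (fun n => rnorm (x n))) => [n|]; first exact: rnormS_ge0.
transitivity (lp_sum 1 x); last by rewrite lp_sum_rnorm powRr1 ?rnorm_ge0.
by apply: eq_eseriesr => n _; rewrite powRr1 ?rnormS_ge0.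
Qed.

Lemma ell1_partial (x : ell1) n : \sum_(i < n) rnorm (x i) <= rnorm x.
Proof.
have := lp_sum_ge_partial 1 x n; rewrite lp_sum_rnorm lee_fin powRr1 ?rnorm_ge0//.
by under eq_bigr do rewrite powRr1 ?rnormS_ge0//.
Qed.

Lemma rnorm_sum (V : normedModType K) (I : Type) (r : seq I) (P : pred I) (F : I -> V) :
  rnorm (\sum_(i <- r | P i) F i) <= \sum_(i <- r | P i) rnorm (F i).
Proof.
elim/big_ind2 : _ => [|a b c d ab cd|//]; first by rewrite rnorm0.
exact: le_trans (rnormD _ _) (lerD ab cd).
Qed.

(** The partial sums are Cauchy: |x_i y_i| <= |x_i|^2 + |y_i|^2, and both series of squares have
    small tails. *)
Lemma dot_cvg (x y : ell2) :
  (fun n => \sum_(i < n) x i * conjS (y i)) @ \oo --> dot x y.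
Proof.
have -> : (fun n => \sum_(i < n) x i * conjS (y i)) =
    series (fun n => x n * conjS (y n)).
  by apply/funext => n; rewrite /series /= big_mkord.
apply: (@cauchy_rnorm_cvg R k K^o) => [|e e0]; first exact: scalars_cauchy_cvg.
have e20 : 0 < e / 2 by rewrite divr_gt0.
have /cvgrPdist_lt/(_ _ e20) [N1 _ hN1] := @ell2_cvg x.
have /cvgrPdist_lt/(_ _ e20) [N2 _ hN2] := @ell2_cvg y.
exists (maxn N1 N2) => n Nn.
rewrite /series /= (big_cat_nat (leq0n _) Nn)//= addrAC subrr add0r.
have := hN1 (maxn N1 N2) (leq_maxl _ _); have := hN2 (maxn N1 N2) (leq_maxr _ _).
rewrite /= => hy hx.
apply: le_lt_trans (@rnorm_sum K^o _ _ _ _) _.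
have := ell2_partial x n; have := ell2_partial y n.
move: hy hx.
rewrite -!(big_mkord xpredT (fun i => rnorm (x i) ^+ 2)).
rewrite -!(big_mkord xpredT (fun i => rnorm (y i) ^+ 2)).
rewrite (big_cat_nat (leq0n _) Nn)/= [in X in _ -> _ -> _ -> X -> _](big_cat_nat (leq0n _) Nn)/=.
set Y := \sum_(0 <= i < _) _; set Y' := \sum_(_ <= i < n) _.
set X := \sum_(0 <= i < _) _; set X' := \sum_(_ <= i < n) _.
move=> /ltr_normlP[_ hy] /ltr_normlP[_ hx] hy' hx'.
apply: (@le_lt_trans _ _ (X' + Y')); last by lra.
rewrite -big_split/=; apply: ler_sum => i _.
rewrite rnormSM rnorm_conjS.
have := sqr_ge0 (rnorm (x i) - rnorm (y i)).
have := sqr_ge0 (rnorm (x i) + rnorm (y i)).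
by rewrite !expr2; nra.
Qed.

Lemma dot_unique (x y : ell2) (l : K) :
  (fun n => \sum_(i < n) x i * conjS (y i)) @ \oo --> l -> dot x y = l.
Proof. exact: (@norm_cvg_unique _ K^o _ _ _ _ (@dot_cvg x y)). Qed.

Lemma dot_linear (a : K) (x y z : ell2) :
  dot (a *: x + y) z = a * dot x z + dot y z.
Proof.
apply: dot_unique.
rewrite (_ : (fun n => _) = (fun n => a *: (\sum_(i < n) x i * conjS (z i) : K^o) +
    \sum_(i < n) y i * conjS (z i))); last first.
  apply/funext => n; rewrite scaler_sumr -big_split/=; apply: eq_bigr => i _.
  rewrite -[a *: (x i * _)]/(a * (x i * _)) mulrA -mulrDl.
  by [].
by apply: cvgD; [apply: cvgZr; exact: dot_cvg | exact: dot_cvg].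
Qed.

Lemma dot_conj (x y : ell2) : dot y x = conjS (dot x y).
Proof.
apply: dot_unique; apply: (@cvg_rnorm R k K^o).
apply: cvg_eqfun (@rnorm_cvg R k K^o _ _ _ _ _ (@dot_cvg x y)) => n /=.
rewrite -rnorm_conjS rmorphB rmorph_sum/=; congr (rnorm (_ - _)).
by apply: eq_bigr => i _; rewrite rmorphM /= conjSK mulrC.
Qed.

Lemma dot_norm (x : ell2) : dot x x = `|x| ^+ 2.
Proof.
apply: dot_unique; apply: (@cvg_rnorm R k K^o).
apply: cvg_eqfun (@rnorm_cvg R RealScalars R^o _ _ _ _ _ (@ell2_cvg x)) => n /=.
have -> : \sum_(i < n) x i * conjS (x i) = ofR (\sum_(i < n) rnorm (x i) ^+ 2).
  rewrite rmorph_sum; apply: eq_bigr => i _.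
  by rewrite mul_conjS -ofR_rnormS -rmorphXn /= reS_ofR.
by rewrite -(ofR_rnorm x) -rmorphXn -rmorphB /= norm_ofR !reS_ofR.
Qed.

End Ell12Theory.

(** * The inner product of l2 *)

Lemma cvg0_le (R : realType) (a b : nat -> R) (c : R) :
  (forall n, 0 <= a n <= b n * c) -> b @ \oo --> (0 : R) -> a @ \oo --> (0 : R).
Proof.
move=> ab b0; apply: (squeeze_cvgr (f := fun=> 0) (h := fun n => b n * c)).
- exact: nearW.
- exact: cvg_cst.
- by rewrite -[X in _ --> X](mul0r c); apply: cvgMl.
Qed.

Section Linear.
Context (K : numFieldType) (U V : normedModType K).

(** Carrying the proof of linearity as an argument lets a function built inside a proof receive the
    structure of a linear map. *)
Definition linear_of (f : U -> V) (hf : linear f) : U -> V := f.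

HB.instance Definition _ (f : U -> V) (hf : linear f) :=
  GRing.isLinear.Build K U V *:%R (linear_of hf) hf.

End Linear.

Section DotTheory.
Context (R : realType) (k : scalar_kind).
Local Notation K := (scalars R k).
Local Notation ell1 := (ell1 R k).
Local Notation ell2 := (ell2 R k).
Local Notation conjS := (@conjS R k).
Local Notation ofR := (@ofR R k).
Local Notation delta := (delta R k).

Lemma dotDl (x y z : ell2) : dot (x + y) z = dot x z + dot y z.
Proof. by rewrite -[x in LHS]scale1r dot_linear mul1r. Qed.

Lemma dot0l (z : ell2) : dot 0 z = 0.
Proof. by apply: (addrI (dot 0 z)); rewrite -dotDl !addr0. Qed.

Lemma dotZl (a : K) (x z : ell2) : dot (a *: x) z = a * dot x z.
Proof. by rewrite -[a *: x]addr0 dot_linear dot0l addr0. Qed.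

Lemma dotBl (x y z : ell2) : dot (x - y) z = dot x z - dot y z.
Proof. by rewrite dotDl -scaleN1r dotZl mulN1r. Qed.

Lemma dot_suml (I : Type) (r : seq I) (P : pred I) (F : I -> ell2) (z : ell2) :
  dot (\sum_(i <- r | P i) F i) z = \sum_(i <- r | P i) dot (F i) z.
Proof. exact: (big_morph (fun x => dot x z) (fun x y => dotDl x y z) (dot0l z)). Qed.

Lemma dotDr (x y z : ell2) : dot z (x + y) = dot z x + dot z y.
Proof. by rewrite !(dot_conj _ z) dotDl rmorphD. Qed.

Lemma dotZr (a : K) (x z : ell2) : dot z (a *: x) = conjS a * dot z x.
Proof. by rewrite !(dot_conj _ z) dotZl rmorphM. Qed.

Lemma dotBr (x y z : ell2) : dot z (x - y) = dot z x - dot z y.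
Proof. by rewrite !(dot_conj _ z) dotBl rmorphB. Qed.

Lemma dot_rnorm (x : ell2) : dot x x = ofR (rnorm x ^+ 2).
Proof. by rewrite dot_norm -ofR_rnorm rmorphXn reS_ofR. Qed.

Lemma re_dot (x : ell2) : reS (dot x x) = rnorm x ^+ 2.
Proof. by rewrite dot_rnorm reS_ofR. Qed.

Lemma dot_delta (x : ell2) n : dot x (delta n) = x n.
Proof.
apply: dot_unique; apply: cvg_near_cst; exists n.+1 => // m /= nm.
rewrite (bigD1 (Ordinal nm))//= eqxx rmorph1 mulr1 big1 ?addr0// => i.
by rewrite -val_eqE /= => /negPf ->; rewrite rmorph0 mulr0.
Qed.

Lemma self_adjoint_dot (B : ell2 -> ell2) : self_adjoint B ->
  forall x y, dot (B y) x = conjS (dot (B x) y).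
Proof. by move=> hB x y; rewrite hB -dot_conj. Qed.

(** Positivity at x - t c y, with t real and c = <Bx, y>; the factor c turns the cross terms into
    the real number -2 t |c|^2. *)
Lemma psd_cauchy_schwarz (B : {linear ell2 -> ell2}) (x y : ell2) :
  self_adjoint B -> positive B ->
  rnorm (dot (B x) y) ^+ 2 <= reS (dot (B x) x) * reS (dot (B y) y).
Proof.
move=> sB pB; set c := dot (B x) y.
set N := rnorm c ^+ 2; set a := reS (dot (B x) x); set b := reS (dot (B y) y).
have a0 : 0 <= a by exact: reS_ge0.
have b0 : 0 <= b by exact: reS_ge0.
have N0 : 0 <= N by exact: sqr_ge0.
have key (t : R) : 0 <= a - 2 * t * N + t ^+ 2 * N * b.
  have := pB (x - (ofR t * c) *: y).
  rewrite linearB linearZ /= dotBl !dotBr !dotZl !dotZr (self_adjoint_dot sB x y).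
  rewrite -/c -(ofR_reS (pB x)) -(ofR_reS (pB y)) -/a -/b.
  rewrite rmorphM /= conjS_ofR.
  have cc : c * conjS c = ofR N by rewrite mul_conjS -ofR_rnormS -rmorphXn.
  rewrite (_ : _ - _ = ofR a - 2 * ofR t * (c * conjS c) +
      ofR t ^+ 2 * (c * conjS c) * ofR b); last by ring.
  rewrite cc -(ofR_ge0 k); congr (is_true (_ <= _)).
  by rewrite rmorphD rmorphB !rmorphM rmorph_nat.
have [N00|N1] := eqVneq N 0; first by rewrite N00 mulr_ge0.
have Ngt : 0 < N by rewrite lt0r N1.
(* For b = 0 the expression in [key] is affine in t, and this t gives it the value -1. Otherwise t =
   1/b is its minimizer. *)
have [b00|b1] := eqVneq b 0.
  have := key ((a + 1) / (2 * N)); rewrite b00 mulr0 addr0.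
  rewrite [X in a - X](_ : _ = a + 1); last by field.
  by rewrite opprD addrA subrr sub0r; lra.
have bgt : 0 < b by rewrite lt0r b1.
have := key b^-1.
rewrite (_ : _ + _ = a - N / b); last by field.
by rewrite subr_ge0 ler_pdivrMr.
Qed.

Lemma dot_cauchy_schwarz (x y : ell2) : rnorm (dot x y) <= rnorm x * rnorm y.
Proof.
have := @psd_cauchy_schwarz idfun x y.
rewrite /= !re_dot -exprMn => h.
rewrite -ler_sqr ?nnegrE ?mulr_ge0 ?rnorm_ge0 ?rnormS_ge0//; apply: h => // z.
by rewrite dot_rnorm ofR_ge0 sqr_ge0.
Qed.

(** Cauchy-Schwarz for the form of B at x and Bx gives |Bx|^4 <= <Bx, x> <BBx, Bx> <= |x|^2
    |Bx|^2. *)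
Lemma psd_contraction (B : {linear ell2 -> ell2}) :
  self_adjoint B -> positive B ->
  (forall x, reS (dot (B x) x) <= rnorm x ^+ 2) ->
  forall x, rnorm (B x) <= rnorm x.
Proof.
move=> sB pB B1 x; have := psd_cauchy_schwarz x (B x) sB pB.
rewrite dot_rnorm rnorm_ofR ?sqr_ge0//.
set u := rnorm (B x); set v := rnorm x => h.
have u0 : 0 <= u by exact: rnorm_ge0.
have v0 : 0 <= v by exact: rnorm_ge0.
have h2 : (u ^+ 2) ^+ 2 <= v ^+ 2 * u ^+ 2.
  apply: le_trans h _; apply: ler_pM; rewrite ?B1//; exact: reS_ge0.
have [u00|u1] := eqVneq u 0; first by rewrite u00.
by rewrite -ler_sqr ?nnegrE// -(@ler_pM2r _ (u ^+ 2)) ?exprn_gt0 ?lt0r ?u1.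
Qed.

Lemma dot_cvgl (u : nat -> ell2) (l y : ell2) : u @ \oo --> l ->
  (fun n => dot (u n) y : K^o) @ \oo --> (dot l y : K^o).
Proof.
move=> ul; apply: (@cvg_rnorm R k K^o).
apply: (@cvg0_le R _ (fun n => rnorm (l - u n)) (rnorm y)); last exact: rnorm_cvg ul.
move=> n; by rewrite rnormS_ge0 /= -dotBl dot_cauchy_schwarz.
Qed.

Lemma ell2_extensional (x y : ell2) : (forall n, x n = y n) -> x = y.
Proof. by move=> xy; apply/val_inj/funext. Qed.

Lemma dot_sum_delta (x : ell2) n (c : nat -> K) :
  dot x (\sum_(i < n) c i *: delta i) = \sum_(i < n) conjS (c i) * x i.
Proof.
rewrite dot_conj dot_suml rmorph_sum; apply: eq_bigr => i _ /=.
by rewrite -dot_conj dotZr dot_delta.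
Qed.

Lemma sum_delta_rnorm n (c : nat -> K) :
  rnorm (\sum_(i < n) c i *: delta i) ^+ 2 = \sum_(i < n) rnorm (c i) ^+ 2.
Proof.
rewrite -[LHS](reS_ofR k) -dot_rnorm dot_sum_delta -[RHS](reS_ofR k); congr reS.
rewrite rmorph_sum; apply: eq_bigr => i _ /=.
have -> : (\sum_(j < n) c j *: delta j) = ell_trunc (le12 R) n c by [].
by rewrite ell_truncE ltn_ord mulrC mul_conjS -ofR_rnormS -rmorphXn reS_ofR.
Qed.

Lemma trunc_cvg (x : ell2) : (fun n => \sum_(i < n) x i *: delta i) @ \oo --> x.
Proof.
apply: cvg_rnorm.
(* Pythagoras: the truncation is the orthogonal projection onto the first n coordinates. *)
have sq n : rnorm (x - \sum_(i < n) x i *: delta i) ^+ 2 =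
    rnorm x ^+ 2 - \sum_(i < n) rnorm (x i) ^+ 2.
  rewrite -[LHS](reS_ofR k) -dot_rnorm dotBl !dotBr !dot_rnorm sum_delta_rnorm.
  rewrite dot_sum_delta (dot_conj _ (\sum_(i < n) _)) dot_sum_delta.
  have -> : \sum_(i < n) conjS (x i) * x i = ofR (\sum_(i < n) rnorm (x i) ^+ 2).
    rewrite rmorph_sum; apply: eq_bigr => i _ /=.
    by rewrite mulrC mul_conjS -ofR_rnormS -rmorphXn reS_ofR.
  by rewrite conjS_ofR subrr subr0 -rmorphB reS_ofR.
have : (fun n => rnorm (x - \sum_(i < n) x i *: delta i) ^+ 2) @ \oo --> (0 : R).
  have h : (fun n => rnorm x ^+ 2 - \sum_(i < n) rnorm (x i) ^+ 2) @ \oo -->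
      (rnorm x ^+ 2 - rnorm x ^+ 2 : R).
    by apply: cvgB; [exact: cvg_cst | exact: ell2_cvg].
  rewrite subrr in h; apply: cvg_eqfun h => n.
  by rewrite sq.
move=> h.
have h2 : (fun n => Num.sqrt (rnorm (x - \sum_(i < n) x i *: delta i) ^+ 2)) @ \oo -->
    (Num.sqrt 0 : R).
  by apply: continuous_cvg h; exact: sqrt_continuous.
rewrite sqrtr0 in h2; apply: cvg_eqfun h2 => n.
by rewrite sqrtr_sqr ger0_norm// rnorm_ge0.
Qed.

End DotTheory.

(** * Square roots of positive operators *)

Lemma cvg_le_cst (R : realType) (u : nat -> R) (l c : R) :
  u @ \oo --> l -> (forall n, u n <= c) -> l <= c.
Proof.
move=> ul uc; rewrite -(cvg_lim (@Rhausdorff R) ul).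
by apply: limr_le; [exact: cvgP ul | exact: nearW].
Qed.

Section SquareRoot.
Context (R : realType) (k : scalar_kind).
Local Notation K := (scalars R k).
Local Notation ell2 := (ell2 R k).
Local Notation conjS := (@conjS R k).
Local Notation ofR := (@ofR R k).

Lemma dot_cvgr (u : nat -> ell2) (l y : ell2) : u @ \oo --> l ->
  (fun n => dot y (u n) : K^o) @ \oo --> (dot y l : K^o).
Proof.
move=> ul; apply: (@cvg_rnorm R k K^o).
apply: (@cvg0_le R _ (fun n => rnorm (l - u n)) (rnorm y)); last exact: rnorm_cvg ul.
by move=> n; rewrite rnormS_ge0 /= -dotBr mulrC dot_cauchy_schwarz.
Qed.

(** * The square root of 1 - B for a self-adjoint contraction B *)

Section Contraction.
Variable B : {linear ell2 -> ell2}.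
Hypothesis sB : self_adjoint B.
Hypothesis B1 : forall x, rnorm (B x) <= rnorm x.

(* The iteration Y_(n+1) = (B + Y_n^2) / 2 converges to 1 - sqrt(1 - B).  Each
   increment is a polynomial in B with nonnegative coefficients, so its norm is at
   most the same polynomial at 1, which is the increment of the scalar iteration
   y_(n+1) = (1 + y_n^2) / 2.  [dominated] avoids polynomials: it records that bound
   together with membership in the commutant of the commutant of B. *)
Definition dominated (P : {linear ell2 -> ell2}) (c : R) :=
  [/\ 0 <= c, self_adjoint P, forall x, rnorm (P x) <= c * rnorm x &
      forall Q : {linear ell2 -> ell2}, (forall x, Q (B x) = B (Q x)) ->
        forall x, Q (P x) = P (Q x)].

Lemma dominated_self : dominated B 1.
Proof. by split=> // x; rewrite mul1r. Qed.

(** P commutes with B, as B commutes with itself; hence Q, which lies in the bicommutant of B,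
    commutes with P. *)
Lemma dominatedC P Q c d : dominated P c -> dominated Q d ->
  forall x, P (Q x) = Q (P x).
Proof. by move=> [_ _ _ Pc] [_ _ _ Qc] x; apply: Qc => y; rewrite -Pc. Qed.

Lemma dominatedD P Q c d : dominated P c -> dominated Q d ->
  dominated (P \+ Q) (c + d).
Proof.
move=> [c0 sP nP cP] [d0 sQ nQ cQ]; split => [|x y|x|T cT x] /=.
- exact: addr_ge0.
- by rewrite dotDl dotDr sP sQ.
- by rewrite mulrDl; apply: le_trans (rnormD _ _) (lerD _ _).
- by rewrite linearD cP ?cQ.
Qed.

Lemma dominatedM P Q c d : dominated P c -> dominated Q d ->
  dominated (P \o Q) (c * d).
Proof.
move=> hP hQ; have PQ := dominatedC hP hQ.
case: hP hQ => [c0 sP nP cP] [d0 sQ nQ cQ]; split => [|x y|x|T cT x] /=.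
- exact: mulr_ge0.
- by rewrite sP sQ -PQ.
- by apply: le_trans (nP _) _; rewrite -mulrA ler_wpM2l.
- by rewrite (cP T cT) (cQ T cT).
Qed.

Lemma dominatedZ P c (a : R) : 0 <= a -> dominated P c ->
  dominated (ofR a \*: P) (a * c).
Proof.
move=> a0 [c0 sP nP cP]; split => [|x y|x|T cT x] /=.
- exact: mulr_ge0.
- by rewrite dotZl dotZr conjS_ofR sP.
- by rewrite rnormZ rnorm_ofR// -mulrA ler_wpM2l.
- by rewrite linearZ /= cP.
Qed.

Fixpoint iterate (n : nat) : {linear ell2 -> ell2} :=
  if n is m.+1 then ofR 2^-1 \*: (B \+ (iterate m \o iterate m)) else \0.

Fixpoint iterate_bound (n : nat) : R :=
  if n is m.+1 then 2^-1 * (1 + iterate_bound m * iterate_bound m) else 0.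

Local Notation Y := iterate.
Local Notation y := iterate_bound.

Lemma iterate_boundS n : y n.+1 = 2^-1 * (1 + y n * y n).
Proof. by []. Qed.

Lemma iterateS n x : Y n.+1 x = ofR 2^-1 *: (B x + Y n (Y n x)).
Proof. by []. Qed.

Lemma half_ge0 : 0 <= 2^-1 :> R.
Proof. by rewrite invr_ge0. Qed.

Lemma iterate_dominated n : dominated (Y n) (y n).
Proof.
elim: n => [|n IH] /=.
  split=> // [x z|x|T _ x]; rewrite /= ?linear0 ?rnorm0 ?mul0r//.
  by rewrite dot0l dot_conj dot0l rmorph0.
exact: dominatedZ half_ge0 (dominatedD dominated_self (dominatedM IH IH)).
Qed.

(** Y_(n+2) - Y_(n+1) = (Y_(n+1) + Y_n)(Y_(n+1) - Y_n) / 2, because the iterates commute. The scalar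
    increments obey the same recursion. *)
Lemma iterate_increment n : exists2 P : {linear ell2 -> ell2},
  dominated P (y n.+1 - y n) & forall x, Y n.+1 x - Y n x = P x.
Proof.
elim: n => [|n [P hP eP]].
  exists (ofR 2^-1 \*: B) => [|x]; last by rewrite /= addr0 subr0.
  have := dominatedZ half_ge0 dominated_self.
  by congr (dominated _ _); rewrite /= mulr0 addr0 subr0.
exists (ofR 2^-1 \*: ((Y n.+1 \+ Y n) \o P)) => [|x].
  have := dominatedZ half_ge0 (dominatedM
    (dominatedD (iterate_dominated n.+1) (iterate_dominated n)) hP).
  congr (dominated _ _); rewrite (iterate_boundS n.+1) [X in _ = _ - X]iterate_boundS.
  by ring.
rewrite (iterateS n.+1) [X in _ - X]iterateS -scalerBr.
rewrite [RHS]/(ofR 2^-1 *: (Y n.+1 (P x) + Y n (P x))); congr (_ *: _).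
rewrite -eP !linearB.
rewrite (dominatedC (iterate_dominated n.+1) (iterate_dominated n)).
by rewrite addrA subrK opprD addrACA subrr add0r.
Qed.

Lemma iterate_bound_le1 n : 0 <= y n <= 1.
Proof.
elim: n => [|n /andP[y0 y1]] /=; first by rewrite lexx ler01.
by apply/andP; split; nra.
Qed.

Lemma iterate_bound_nondecreasing : nondecreasing_seq y.
Proof.
apply/nondecreasing_seqP => n; rewrite -subr_ge0.
by have [P [P0 _ _ _] _] := iterate_increment n.
Qed.

Lemma iterate_dist n m x : (n <= m)%N ->
  rnorm (Y m x - Y n x) <= (y m - y n) * rnorm x.
Proof.
elim: m => [|m IH]; first by rewrite leqn0 => /eqP ->; rewrite !subrr rnorm0 mul0r.
rewrite leq_eqVlt => /orP[/eqP ->|]; first by rewrite !subrr rnorm0 mul0r.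
rewrite ltnS => /IH {}IH.
rewrite -(subrKA (Y m x)) -(subrKA (y m)) mulrDl.
apply: le_trans (rnormD _ _) (lerD _ IH).
by have [P [_ _ nP _] ->] := iterate_increment m.
Qed.

(** By [iterate_dist] the sequence is Cauchy as soon as the scalar iteration is, and that one is
    nondecreasing and bounded by 1. *)
Lemma iterate_is_cvg x : cvg ((fun n => Y n x) @ \oo).
Proof.
have ycvg : cvgn y.
  apply: nondecreasing_is_cvgn; first exact: iterate_bound_nondecreasing.
  by exists 1 => _ [n _ <-]; case/andP: (iterate_bound_le1 n).
have yl n : y n <= limn y.
  exact: nondecreasing_cvgn_le iterate_bound_nondecreasing ycvg n.
apply: cauchy_rnorm_cvg => [|e e0]; first exact: ell_cauchy_cvg.
(* Adding 1 keeps the divisor positive when x = 0. *)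
have x0 : 0 < rnorm x + 1 by rewrite ltr_wpDl// rnorm_ge0.
have ex0 : 0 < e / (rnorm x + 1) by rewrite divr_gt0.
have /cvgrPdist_lt/(_ _ ex0) [N _ hN] := ycvg.
exists N => n Nn; apply: le_lt_trans (iterate_dist x Nn) _.
have := hN N (leqnn N); rewrite /= => /ltr_normlP[_ hl].
have h1 : y n - y N < e / (rnorm x + 1).
  by apply: le_lt_trans hl; rewrite lerB// yl.
have h2 : 0 <= y n - y N by rewrite subr_ge0 iterate_bound_nondecreasing.
apply: (@le_lt_trans _ _ ((y n - y N) * (rnorm x + 1))).
  by rewrite ler_wpM2l// lerDl.
by rewrite -ltr_pdivlMr.
Qed.

Definition iterate_lim (x : ell2) : ell2 := lim ((fun n => Y n x) @ \oo).

Lemma iterate_cvg x : (fun n => Y n x) @ \oo --> iterate_lim x.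
Proof. exact: iterate_is_cvg. Qed.

Lemma iterate_limE x z : (fun n => Y n x) @ \oo --> z -> iterate_lim x = z.
Proof. exact: (@norm_cvg_unique _ ell2 _ _ _ _ (iterate_cvg (x := x))). Qed.

Lemma iterate_lim_linear : linear iterate_lim.
Proof.
move=> a x z; apply: iterate_limE.
have h : (fun n => a *: Y n x + Y n z) @ \oo --> a *: iterate_lim x + iterate_lim z.
  by apply: cvgD; [apply: cvgZr; exact: iterate_cvg | exact: iterate_cvg].
by apply: cvg_eqfun h => n; rewrite linearP.
Qed.

Lemma iterate_contraction n x : rnorm (Y n x) <= rnorm x.
Proof.
have [_ _ nY _] := iterate_dominated n; apply: le_trans (nY x) _.
by rewrite ler_piMl ?rnorm_ge0//; case/andP: (iterate_bound_le1 n).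
Qed.

Lemma iterate_lim_contraction x : rnorm (iterate_lim x) <= rnorm x.
Proof.
apply: (@cvg_le_cst R (fun n => rnorm (Y n x))) => [|n].
  by apply: cvg_of_rnorm; exact: iterate_cvg.
exact: iterate_contraction.
Qed.

Lemma iterate_lim_self_adjoint : self_adjoint iterate_lim.
Proof.
move=> x z; have h1 := dot_cvgl (y := z) (iterate_cvg (x := x)).
have h2 : (fun n => dot (Y n x) z : K^o) @ \oo --> (dot x (iterate_lim z) : K^o).
  apply: cvg_eqfun (dot_cvgr (y := x) (iterate_cvg (x := z))) => n.
  by have [_ -> _ _] := iterate_dominated n.
exact: (@norm_cvg_unique _ K^o _ _ _ _ h1 h2).
Qed.

(** Pass to the limit in the recursion. With L the limit operator, Y_n (Y_n x) tends to L (L x),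
    since |Y_n (L x) - Y_n (Y_n x)| <= |L x - Y_n x| by contraction. *)
Lemma iterate_lim_fixpoint x :
  iterate_lim x = ofR 2^-1 *: (B x + iterate_lim (iterate_lim x)).
Proof.
apply: iterate_limE; rewrite -(cvg_shiftS (fun n => Y n x)).
apply: cvgZr; apply: cvgD; first exact: cvg_cst.
apply: cvg_rnorm.
have h : (fun n => rnorm (iterate_lim (iterate_lim x) - Y n (iterate_lim x)) +
    rnorm (iterate_lim x - Y n x)) @ \oo --> (0 + 0 : R).
  by apply: cvgD; apply: rnorm_cvg; exact: iterate_cvg.
rewrite addr0 in h; apply: (@cvg0_le R _ _ 1 _ h) => n.
rewrite rnorm_ge0 mulr1 /=.
rewrite -(subrKA (Y n (iterate_lim x))); apply: le_trans (rnormD _ _) _.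
by rewrite lerD2l -linearB iterate_contraction.
Qed.

(** With L the limit operator, 2 L = B + L^2 gives (1 - L)^2 = 1 - B, and 1 - L is positive because
    |<Lx, x>| <= |x|^2. *)
Lemma sqrt_of_contraction : exists S : {linear ell2 -> ell2},
  bounded_psd S /\ forall x, S (S x) = x - B x.
Proof.
pose L : {linear ell2 -> ell2} := linear_of iterate_lim_linear.
exists (idfun \- L); split=> [|x] /=.
  split=> [|x z|x] /=.
  - exists (1 + 1) => x; apply: le_trans (rnormB _ _) _.
    by rewrite mulrDl !mul1r lerD2l iterate_lim_contraction.
  - by rewrite dotBl dotBr iterate_lim_self_adjoint.
  - have -> : dot (x - L x) x = ofR (reS (dot (x - L x) x)).
      apply: conjS_fixed; rewrite dotBl rmorphB /= -!dot_conj.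
      by rewrite [dot (L x) x]iterate_lim_self_adjoint.
    rewrite ofR_ge0 dotBl raddfB /= re_dot subr_ge0.
    have : rnorm (dot (L x) x) <= rnorm x ^+ 2.
      apply: le_trans (dot_cauchy_schwarz _ _) _.
      by rewrite expr2 ler_wpM2r ?rnorm_ge0// iterate_lim_contraction.
    exact: le_trans (reS_le_rnorm _).
change (x - L x - L (x - L x) = x - B x); rewrite linearB.
have e : L x + L x = B x + L (L x).
  have half (u z : ell2) : u = ofR 2^-1 *: z -> u + u = z.
    by move=> ->; rewrite -scalerDl -ofRD -div1r -splitr rmorph1 scale1r.
  exact/half/iterate_lim_fixpoint.
by rewrite opprB -addrA [- L x + _]addrCA -opprD e opprD [_ + (_ - _)]addrCA subrr addr0.
Qed.

End Contraction.

(** For M > 0 bounding the norm of A, B = 1 - A / M is a positive contraction, and sqrt M times the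
    root of 1 - B = A / M is a root of A. *)
Lemma psd_sqrt_exists (A : {linear ell2 -> ell2}) : bounded_psd A ->
  exists S : {linear ell2 -> ell2}, bounded_psd S /\ forall x, S (S x) = A x.
Proof.
move=> [[M0 AM0] sA pA].
(* The given bound M0 may be zero or negative; M is positive in all cases. *)
pose M := `|M0| + 1.
have M_gt0 : 0 < M by rewrite ltr_wpDl.
have AM x : rnorm (A x) <= M * rnorm x.
  apply: le_trans (AM0 x) _; rewrite ler_wpM2r ?rnorm_ge0//.
  by rewrite (le_trans (ler_norm _))// lerDl.
have MV : 0 <= M^-1 by rewrite invr_ge0 ltW.
pose B : {linear ell2 -> ell2} := idfun \- ofR M^-1 \*: A.
have BE x : B x = x - ofR M^-1 *: A x by [].
have sB : self_adjoint B.
  by move=> x z; rewrite !BE dotBl dotBr dotZl dotZr conjS_ofR sA.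
have dotB x : dot (B x) x = ofR (rnorm x ^+ 2 - M^-1 * reS (dot (A x) x)).
  by rewrite BE dotBl dotZl dot_rnorm -{1}(ofR_reS (pA x)) -rmorphM -rmorphB.
have pB : positive B.
  move=> x; rewrite dotB ofR_ge0 subr_ge0 ler_pdivrMl//.
  apply: le_trans (reS_le_rnorm _) _; apply: le_trans (dot_cauchy_schwarz _ _) _.
  by rewrite expr2 mulrA ler_wpM2r ?rnorm_ge0.
have B1 : forall x, rnorm (B x) <= rnorm x.
  apply: psd_contraction => // x; rewrite dotB reS_ofR lerBlDr lerDl.
  by rewrite mulr_ge0// reS_ge0.
have [S [[[C SC] sS pS] SS]] := sqrt_of_contraction sB B1.
have rM : 0 <= Num.sqrt M by exact: sqrtr_ge0.
exists (ofR (Num.sqrt M) \*: S); split=> [|x] /=.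
  split=> [|x z|x] /=.
  - exists (Num.sqrt M * C) => x.
    by rewrite rnormZ rnorm_ofR// -mulrA ler_wpM2l.
  - by rewrite dotZl dotZr conjS_ofR sS.
  - by rewrite dotZl mulr_ge0 ?ofR_ge0.
rewrite linearZ /= SS BE scalerA -rmorphM /= -expr2 sqr_sqrtr ?(ltW M_gt0)//.
by rewrite opprB addrC subrK scalerA -rmorphM mulfV ?gt_eqF// rmorph1 scale1r.
Qed.

(** Existence makes the choice in [sqrt_op] land on a positive square root instead of on its default
    value. *)
Lemma sqrt_opP (A : {linear ell2 -> ell2}) : bounded_psd A ->
  bounded_psd (sqrt_op A) /\ forall x, sqrt_op A (sqrt_op A x) = A x.
Proof.
move=> /psd_sqrt_exists [S hS].
exact: (@xgetI {classic {linear ell2 -> ell2}} _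
  [set S : {linear ell2 -> ell2} | bounded_psd S /\ forall x, S (S x) = A x] S hS).
Qed.

End SquareRoot.

(** * Two-summing operators *)

Section TwoSumming.
Context (R : realType) (k : scalar_kind).
Local Notation K := (scalars R k).

Section General.
Variables (X Y : completeNormedModType K) (T : {linear X -> Y}) (C : R).

Lemma dual_ball_le (f : {linear X -> K^o}) (x : X) :
  dual_ball f -> rnorm (f x) <= rnorm x.
Proof. by move=> /(_ x) fx; apply: ler_reS fx; exact: normr_ge0. Qed.

(** A real bound s replaces the supremum, and any finite type may index the vectors; sums over sign
    vectors need the latter. *)
Lemma two_summing_le (I : finType) (x : I -> X) (s : R) : two_summing_const T C ->
  (forall f : {linear X -> K^o}, dual_ball f -> \sum_i rnorm (f (x i)) ^+ 2 <= s) ->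
  \sum_i rnorm (T (x i)) ^+ 2 <= C ^+ 2 * s.
Proof.
move=> [C0 TC] xs.
have E (F : I -> R) : \sum_(i < #|I|) F (enum_val i) = \sum_i F i.
  by rewrite -(big_enum_val F); exact: eq_bigl.
have := TC #|I| (fun i => x (enum_val i)).
rewrite (E (fun i => rnorm (T (x i)) ^+ 2)) => h.
rewrite -lee_fin; apply: le_trans h _; rewrite [leRHS]EFinM.
rewrite lee_wpmul2l ?lee_fin ?sqr_ge0//.
apply: ge_ereal_sup => _ [f fb <-]; rewrite lee_fin.
by rewrite (E (fun i => rnorm (f (x i)) ^+ 2)) xs.
Qed.

(** The supremum is a real number and can serve as s: it is nonnegative by the zero functional and
    at most the sum of the |x_i|^2. *)
Lemma two_summing_constI : 0 <= C ->
  (forall (N : nat) (x : 'I_N -> X) (s : R),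
    (forall f : {linear X -> K^o}, dual_ball f -> \sum_i rnorm (f (x i)) ^+ 2 <= s) ->
    \sum_i rnorm (T (x i)) ^+ 2 <= C ^+ 2 * s) ->
  two_summing_const T C.
Proof.
move=> C0 TC; split=> // N x; set s := ereal_sup _.
have sup_le f : dual_ball f -> ((\sum_i rnorm (f (x i)) ^+ 2)%:E <= s)%E.
  by move=> fb; apply: ereal_sup_ubound; exists f.
have s0 : (0 <= s)%E.
  apply: le_trans (sup_le \0 _); first by rewrite lee_fin sumr_ge0// => i _; rewrite sqr_ge0.
  by move=> y; rewrite /= normr0 normr_ge0.
have soo : (s <= (\sum_i rnorm (x i) ^+ 2)%:E)%E.
  apply: ge_ereal_sup => _ [f fb <-]; rewrite lee_fin; apply: ler_sum => i _.
  by rewrite ler_sqr ?nnegrE ?rnorm_ge0 ?rnormS_ge0// dual_ball_le.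
have sfin : s \is a fin_num by rewrite ge0_fin_numE// (le_lt_trans soo) ?ltry.
rewrite -(fineK sfin) -EFinM lee_fin; apply: TC => f /sup_le.
by rewrite -(fineK sfin) lee_fin.
Qed.

End General.
End TwoSumming.

(** * From a 2-summing square root to the decomposition of A *)

Section SquareRootTwoSumming.
Context (R : realType) (k : scalar_kind).
Local Notation K := (scalars R k).
Local Notation ell1 := (ell1 R k).
Local Notation ell2 := (ell2 R k).
Local Notation conjS := (@conjS R k).
Local Notation ofR := (@ofR R k).
Local Notation delta := (delta R k).

(** On the vector with coordinates conj (f delta_i) the functional takes the value N, while its norm
    is sqrt N; hence N^2 <= N. *)
Lemma dual_ball_delta (f : {linear ell2 -> K^o}) n :
  dual_ball f -> \sum_(i < n) rnorm (f (delta i)) ^+ 2 <= 1.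
Proof.
move=> fb; set N := \sum_(i < n) _.
pose c i := conjS (f (delta i)).
have := dual_ball_le (\sum_(i < n) c i *: delta i) fb.
have -> : f (\sum_(i < n) c i *: delta i) = ofR N.
  rewrite linear_sum rmorph_sum; apply: eq_bigr => i _.
  rewrite linearZ /= -[c i *: _]/(c i * f (delta i)) mulrC mul_conjS.
  by rewrite -ofR_rnormS -rmorphXn reS_ofR.
have N0 : 0 <= N by apply: sumr_ge0 => i _; exact: sqr_ge0.
rewrite rnorm_ofR// -ler_sqr ?nnegrE ?rnorm_ge0// sum_delta_rnorm.
rewrite (eq_bigr (fun i : 'I_n => rnorm (f (delta i)) ^+ 2)); last first.
  by move=> i _; rewrite rnorm_conjS.
rewrite -/N expr2; have [->|Nn] := eqVneq N 0; first by rewrite ler01.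
by rewrite -{3}[N]mul1r ler_pM2r// lt0r Nn.
Qed.

Lemma two_summing_delta (T : {linear ell2 -> ell1}) (C : R) n :
  two_summing_const T C -> \sum_(i < n) rnorm (T (delta i)) ^+ 2 <= C ^+ 2.
Proof.
move=> hT; rewrite -[leRHS]mulr1; apply: (two_summing_le hT) => f fb.
exact: dual_ball_delta.
Qed.

Lemma rnorm_dot_le_series (u v : ell2) :
  ((rnorm (dot u v))%:E <= \sum_(0 <= n <oo) (rnorm (u n) * rnorm (v n))%:E)%E.
Proof.
have uv0 n : 0 <= rnorm (u n) * rnorm (v n) by rewrite mulr_ge0 ?rnormS_ge0.
have := fun n => nneseries_ge n uv0.
case: (\sum_(0 <= n <oo) _)%E => [c| |] le_c.
- rewrite lee_fin; apply: cvg_le_cst (@cvg_of_rnorm R k K^o _ _ _ _ _ (@dot_cvg _ _ u v)) _.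
  move=> n; apply: le_trans (@rnorm_sum R k K^o _ _ _ _) _.
  have := le_c n; rewrite lee_fin; apply: le_trans.
  by apply: ler_sum => i _; rewrite rnormSM rnorm_conjS.
- exact: leey.
- by have := le_c 0%N; rewrite leeNy_eq.
Qed.

Lemma ell1_series (x : ell1) : (\sum_(0 <= n <oo) (rnorm (x n))%:E)%E = (rnorm x)%:E.
Proof.
transitivity (lp_sum 1 x); last by rewrite lp_sum_rnorm powRr1 ?rnorm_ge0.
by apply: eq_eseriesr => n _; rewrite powRr1 ?rnormS_ge0.
Qed.

(** A sum of squares of nonnegative numbers is at most the square of their sum. *)
Lemma ell12_rnorm_le (x : ell1) : rnorm (ell12 x) <= rnorm x.
Proof.
rewrite -ler_sqr ?nnegrE ?rnorm_ge0//.
apply: cvg_le_cst (@ell2_cvg _ _ (ell12 x)) _ => n.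
apply: (@le_trans _ _ ((\sum_(i < n) rnorm (x i)) ^+ 2)); last first.
  rewrite ler_sqr ?nnegrE ?rnorm_ge0 ?ell1_partial//.
  by apply: sumr_ge0 => i _; exact: rnormS_ge0.
elim: n => [|n IH]; first by rewrite !big_ord0 expr0n.
rewrite !big_ord_recr /= sqrrD -addrA lerD// lerDr mulrn_wge0// mulr_ge0 ?rnormS_ge0//.
by apply: sumr_ge0 => i _; exact: rnormS_ge0.
Qed.

Section Factorization.
Variables (A S : {linear ell2 -> ell2}).
Hypothesis psdA : bounded_psd A.
Hypothesis psdS : bounded_psd S.
Hypothesis SS : forall x, S (S x) = A x.

Lemma sqrt_coord (x : ell2) n : S x n = dot x (S (delta n)).
Proof. by case: psdS => _ <- _; rewrite dot_delta. Qed.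

Lemma sqrt_entry_sym m n : rnorm (S (delta m) n) = rnorm (S (delta n) m).
Proof. by rewrite sqrt_coord dot_conj rnorm_conjS dot_delta. Qed.

Lemma dot_sqrt (x y : ell2) : dot (A x) y = dot (S x) (S y).
Proof. by case: psdS => _ sS _; rewrite -SS sS. Qed.

Section TwoSummingRoot.
Variables (T : {linear ell2 -> ell1}) (C : R).
Hypothesis TS : forall x, ell12 (T x) = S x.
Hypothesis TC : two_summing_const T C.

Lemma two_summing_coord x n : T x n = S x n.
Proof. by rewrite -TS. Qed.

(** Apply the bounded operator S to the basis expansion of S v, whose i-th coordinate is <v, S
    delta_i>. *)
Lemma strong_decomposition_sqrt : strong_decomposition A (fun n => T (delta n)).
Proof.
move=> v.
have h : (fun n => S (\sum_(i < n) S v i *: delta i)) @ \oo --> S (S v).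
  apply: cvg_rnorm; case: psdS => -[M SM] _ _.
  apply: (@cvg0_le R _ (fun n => rnorm (S v - \sum_(i < n) S v i *: delta i)) M).
    by move=> n; rewrite rnorm_ge0 -linearB mulrC SM.
  by apply: rnorm_cvg; exact: trunc_cvg.
rewrite -SS; apply: cvg_eqfun h => n.
rewrite linear_sum; apply: eq_bigr => i _.
by rewrite linearZ /= sqrt_coord /rank_one TS.
Qed.

Lemma two_summing_series :
  (\sum_(0 <= n <oo) (rnorm (T (delta n)) ^+ 2)%:E <= (C ^+ 2)%:E)%E.
Proof.
apply: nneseries_le => [n|n]; first exact: sqr_ge0.
by rewrite lee_fin two_summing_delta.
Qed.

Lemma gamma_plus_sqrt : (gamma_plus A <= (C ^+ 2)%:E)%E.
Proof.
apply: le_trans two_summing_series; apply: ereal_inf_lbound.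
by exists (fun n => T (delta n)) => //; exact: strong_decomposition_sqrt.
Qed.

(** |<A delta_i, delta_j>| = |<S delta_i, S delta_j>| is at most the sum over n of |(S delta_n)_i|
    |(S delta_n)_j|, as the moduli of the entries of S are symmetric. Summing over i and j before n
    leaves the sum of the |T delta_n|_1^2. *)
Lemma norm11_sqrt : (norm11 A <= (C ^+ 2)%:E)%E.
Proof.
pose a i j : \bar R := (rnorm (dot (A (delta i)) (delta j)))%:E.
pose b n i j := rnorm (T (delta n) i) * rnorm (T (delta n) j).
have b0 n i j : (0 <= (b n i j)%:E)%E by rewrite lee_fin mulr_ge0 ?rnormS_ge0.
have ab i j : (a i j <= \sum_(0 <= n <oo) (b n i j)%:E)%E.
  rewrite /a dot_sqrt; apply: le_trans (rnorm_dot_le_series _ _) _.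
  apply: lee_nneseries => [n _ _|n _]; first by rewrite lee_fin mulr_ge0 ?rnormS_ge0.
  by rewrite /b !two_summing_coord (sqrt_entry_sym i) (sqrt_entry_sym j).
(* The unordered sum over pairs becomes an iterated series, in which the order of summation can be
   exchanged. *)
have -> : norm11 A = (\sum_(0 <= i <oo) \sum_(0 <= j <oo) a i j)%E.
  rewrite nneseries_esumT; last first.
    by move=> n; apply: nneseries_ge0 => m _ _; rewrite lee_fin rnormS_ge0.
  under eq_esum => i _.
    rewrite nneseries_esumT; last by move=> m; rewrite lee_fin rnormS_ge0.
    over.
  rewrite esum_esum => [|i j _ _]; last by rewrite lee_fin rnormS_ge0.
  by rewrite /norm11 -setXTT.
apply: le_trans two_summing_series.
apply: (@le_trans _ _ (\sum_(0 <= i <oo) \sum_(0 <= j <oo) \sum_(0 <= n <oo) (b n i j)%:E)%E).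
  apply: lee_nneseries => [i _ _|i _].
    by apply: nneseries_ge0 => m _ _; rewrite lee_fin rnormS_ge0.
  by apply: lee_nneseries => [j _ _|j _]; rewrite ?lee_fin ?rnormS_ge0.
have e i : (\sum_(0 <= j <oo) \sum_(0 <= n <oo) (b n i j)%:E =
    \sum_(0 <= n <oo) (rnorm (T (delta n)) * rnorm (T (delta n) i))%:E)%E.
  rewrite nneseries_interchange//; apply: eq_eseriesr => n _.
  under eq_eseriesr do rewrite /b EFinM.
  rewrite nneseriesZl ?ell1_series; last by move=> j _; rewrite lee_fin rnormS_ge0.
  by rewrite -EFinM mulrC.
under eq_eseriesr do rewrite e.
rewrite nneseries_interchange; last by move=> i n; rewrite lee_fin mulr_ge0 ?rnormS_ge0 ?rnorm_ge0.
apply: lee_nneseries => [n _ _|n _].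
  by apply: nneseries_ge0 => i _ _; rewrite lee_fin mulr_ge0 ?rnormS_ge0 ?rnorm_ge0.
under eq_eseriesr do rewrite EFinM.
rewrite nneseriesZl ?ell1_series; last by move=> j _; rewrite lee_fin rnormS_ge0.
by rewrite -EFinM expr2.
Qed.

Lemma Gamma_plus_sqrt : Gamma_plus A.
Proof.
split; first split => //.
  exact: le_lt_trans norm11_sqrt (ltry _).
exact: le_lt_trans gamma_plus_sqrt (ltry _).
Qed.

End TwoSummingRoot.
End Factorization.
End SquareRootTwoSumming.

(** For B nonzero, the sum of the squares (B a_i - P b_i)^2 equals B (A B - P^2). *)
Lemma cauchy_schwarz_sum (R : realFieldType) (I : finType) (a b : I -> R) :
  (\sum_i a i * b i) ^+ 2 <= (\sum_i a i ^+ 2) * (\sum_i b i ^+ 2).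
Proof.
set P := \sum_i a i * b i; set A := \sum_i a i ^+ 2; set B := \sum_i b i ^+ 2.
have B0 : 0 <= B by apply: sumr_ge0 => i _; exact: sqr_ge0.
have [Bz|Bn] := eqVneq B 0.
  have b_eq0 i : b i = 0.
    apply/eqP; rewrite -sqrf_eq0; move/eqP: Bz; rewrite /B psumr_eq0.
      by move=> /allP/(_ i); rewrite mem_index_enum; exact.
    by move=> j _; exact: sqr_ge0.
  rewrite Bz mulr0 /P big1 ?expr0n// => i _.
  by rewrite b_eq0 mulr0.
have : 0 <= \sum_i (B * a i - P * b i) ^+ 2.
  by apply: sumr_ge0 => i _; exact: sqr_ge0.
have -> : \sum_i (B * a i - P * b i) ^+ 2 = B * (A * B - P ^+ 2).
  transitivity (\sum_i (B ^+ 2 * a i ^+ 2 - 2 * B * P * (a i * b i) + P ^+ 2 * b i ^+ 2)).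
    by apply: eq_bigr => i _; ring.
  by rewrite big_split sumrB /= -!mulr_sumr -/A -/B -/P; ring.
by rewrite pmulr_rge0 ?lt0r ?Bn// subr_ge0.
Qed.

(** Minkowski's inequality for vectors of norms at most v sqrt s and w sqrt s, squared so that no
    root appears; Cauchy-Schwarz bounds the cross term. *)
Lemma sum_sqrD_le (R : realFieldType) (I : finType) (a b : I -> R) (v w s : R) :
  0 <= v -> 0 <= w -> 0 <= s ->
  \sum_i a i ^+ 2 <= v ^+ 2 * s -> \sum_i b i ^+ 2 <= w ^+ 2 * s ->
  \sum_i (a i + b i) ^+ 2 <= (v + w) ^+ 2 * s.
Proof.
move=> v0 w0 s0 av bw.
have ab : \sum_i a i * b i <= v * w * s.
  have vws : 0 <= v * w * s by rewrite !mulr_ge0.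
  have [|ab0] := ltP (\sum_i a i * b i) 0; first by move=> /ltW/le_trans; exact.
  rewrite -ler_sqr ?nnegrE//; apply: le_trans (cauchy_schwarz_sum a b) _.
  rewrite (_ : (v * w * s) ^+ 2 = (v ^+ 2 * s) * (w ^+ 2 * s)); last by ring.
  by rewrite ler_pM// sumr_ge0// => i _; exact: sqr_ge0.
have -> : \sum_i (a i + b i) ^+ 2 =
    \sum_i a i ^+ 2 + \sum_i b i ^+ 2 + 2 * \sum_i a i * b i.
  by rewrite mulr_sumr -!big_split /=; apply: eq_bigr => i _; ring.
rewrite (_ : (v + w) ^+ 2 * s = v ^+ 2 * s + w ^+ 2 * s + 2 * (v * w * s)); last by ring.
by rewrite lerD ?lerD// ler_wpM2l.
Qed.

(** * Summable column norms make the square root 2-summing into l1 *)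

Section SummableColumns.
Context (R : realType) (k : scalar_kind).
Local Notation K := (scalars R k).
Local Notation ell1 := (ell1 R k).
Local Notation ell2 := (ell2 R k).
Local Notation ofR := (@ofR R k).
Local Notation delta := (delta R k).

Section Corestriction.
Variables (S : {linear ell2 -> ell2}).
Hypothesis S1 : forall x, ell_seq (S x) \in lp_pred 1.

Definition corestrict (x : ell2) : ell1 := Ell (lexx 1) (S1 x).

Lemma corestrict_linear : linear corestrict.
Proof.
move=> a x y; apply/val_inj => /=.
by rewrite linearP.
Qed.

End Corestriction.

Lemma dot_linear_l (y : ell2) : linear (fun x : ell2 => dot x y : K^o).
Proof. by move=> a x z; rewrite dot_linear. Qed.

Variables (S : {linear ell2 -> ell2}) (d : R).
Hypothesis psdS : bounded_psd S.
Hypothesis dS : (\sum_(0 <= n <oo) (rnorm (S (delta n)))%:E)%E = d%:E.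

Lemma column_sum_le n : \sum_(i < n) rnorm (S (delta i)) <= d.
Proof. by rewrite -lee_fin -dS nneseries_ge// => i; exact: rnorm_ge0. Qed.

Lemma column_sum_ge0 : 0 <= d.
Proof. by have := column_sum_le 0; rewrite big_ord0. Qed.

Lemma sqrt_coord_le x n : rnorm (S x n) <= rnorm x * rnorm (S (delta n)).
Proof. by rewrite (sqrt_coord psdS) dot_cauchy_schwarz. Qed.

Lemma sqrt_ell1 x : ell_seq (S x) \in lp_pred 1.
Proof.
apply/lp_predP; apply: (@le_lt_trans _ _ (rnorm x * d)%:E); last exact: ltry.
apply: nneseries_le => [n|n]; first exact: powR_ge0.
rewrite lee_fin; apply: (@le_trans _ _ (rnorm x * \sum_(i < n) rnorm (S (delta i)))).
  rewrite mulr_sumr; apply: ler_sum => i _.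
  by rewrite powRr1 ?rnormS_ge0// sqrt_coord_le.
by rewrite ler_wpM2l ?rnorm_ge0 ?column_sum_le.
Qed.

Definition sqrt_to_ell1 : {linear ell2 -> ell1} := linear_of (corestrict_linear sqrt_ell1).

Lemma sqrt_to_ell1E x : ell12 (sqrt_to_ell1 x) = S x.
Proof. exact: ell2_extensional. Qed.

(** The m-th coordinate of S is w times the functional <., S delta_m> / w, which lies in the dual
    ball; for w = 0 the coordinate vanishes. *)
Lemma sqrt_coord_two_summing (N : nat) (x : 'I_N -> ell2) (s : R) m :
  (forall f : {linear ell2 -> K^o}, dual_ball f -> \sum_i rnorm (f (x i)) ^+ 2 <= s) ->
  \sum_i rnorm (S (x i) m) ^+ 2 <= rnorm (S (delta m)) ^+ 2 * s.
Proof.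
move=> xs; set w := rnorm (S (delta m)).
have w0 : 0 <= w by exact: rnorm_ge0.
have [wz|wn] := eqVneq w 0.
  rewrite wz expr0n mul0r big1// => i _.
  suff -> : rnorm (S (x i) m) = 0 by rewrite expr0n.
  apply/eqP; rewrite eq_le rnormS_ge0 andbT.
  by have := sqrt_coord_le (x i) m; rewrite -/w wz mulr0.
pose f : {linear ell2 -> K^o} := linear_of (dot_linear_l (ofR w^-1 *: S (delta m))).
have fE z : rnorm (S z m) = w * rnorm (f z).
  rewrite (sqrt_coord psdS) [f z]dotZr conjS_ofR rnormSM rnorm_ofR ?invr_ge0//.
  by rewrite mulrA mulfV// mul1r.
have fb : dual_ball f.
  move=> z; apply: (@rnorm_le _ _ K^o); rewrite -(ler_pM2l (x := w)) ?lt0r ?wn// -fE.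
  by rewrite mulrC sqrt_coord_le.
under eq_bigr do rewrite fE exprMn.
by rewrite -mulr_sumr ler_wpM2l ?sqr_ge0// xs.
Qed.

Lemma sqrt_two_summing : two_summing_const sqrt_to_ell1 d.
Proof.
apply: two_summing_constI column_sum_ge0 _ => N x s xs.
have s0 : 0 <= s.
  apply: le_trans (xs \0 _); first by apply: sumr_ge0 => i _; rewrite sqr_ge0.
  by move=> y; rewrite /= normr0 normr_ge0.
(* Minkowski's inequality adds one coordinate at a time, and with it one column norm to the
   constant. *)
have partial n : \sum_i (\sum_(m < n) rnorm (S (x i) m)) ^+ 2 <=
    (\sum_(m < n) rnorm (S (delta m))) ^+ 2 * s.
  elim: n => [|n IH].
    apply: (@le_trans _ _ 0); last by rewrite mulr_ge0 ?sqr_ge0.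
    by rewrite big1// => i _; rewrite big_ord0 expr0n.
  under eq_bigr do rewrite big_ord_recr /=.
  rewrite [in leRHS]big_ord_recr /=; apply: sum_sqrD_le => //.
  - by apply: sumr_ge0 => i _; exact: rnorm_ge0.
  - exact: rnorm_ge0.
  - exact: sqrt_coord_two_summing.
(* The truncated l1 norms tend to the full ones, so the bound by d survives in the limit. *)
have lim : (fun n => \sum_i (\sum_(m < n) rnorm (S (x i) m)) ^+ 2) @ \oo -->
    (\sum_i rnorm (sqrt_to_ell1 (x i)) ^+ 2 : R).
  apply: cvg_big => [|i _]; first exact: add_continuous.
  by rewrite expr2; apply: cvgM; exact: (@ell1_cvg _ _ (sqrt_to_ell1 (x i))).
apply: cvg_le_cst lim _ => n; apply: le_trans (partial n) _.
rewrite ler_wpM2r// ler_sqr ?nnegrE ?column_sum_le ?column_sum_ge0//.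
by apply: sumr_ge0 => i _; exact: rnorm_ge0.
Qed.

End SummableColumns.

(** * Grothendieck's inequality *)

Section Signs.
Context (R : realType) (k : scalar_kind) (M : nat).
Local Notation K := (scalars R k).
Local Notation ofR := (@ofR R k).
Local Notation signs := {ffun 'I_M -> bool}.

Definition sign (e : signs) (i : 'I_M) : R := (-1) ^+ e i.

Lemma sign_sqr e i : sign e i * sign e i = 1.
Proof. by rewrite /sign -signr_addb addbb. Qed.

Lemma norm_sign e i : `|ofR (sign e i)| = 1.
Proof. by rewrite norm_ofR normr_sign rmorph1. Qed.

Lemma card_signs : #|signs| = (2 ^ M)%N.
Proof. by rewrite card_ffun card_bool card_ord. Qed.

Lemma sum_sign_mul (i j : 'I_M) :
  \sum_e sign e i * sign e j = if i == j then 2 ^+ M else 0.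
Proof.
have [->|ij] := eqVneq i j.
  under eq_bigr do rewrite sign_sqr.
  by rewrite sumr_const card_signs natrX.
(* Flipping the i-th sign permutes the sign vectors and negates each summand, so the sum equals its
   opposite. *)
pose flip (e : signs) : signs := [ffun l => (l == i) (+) e l].
have flipK : involutive flip.
  by move=> e; apply/ffunP => l; rewrite !ffunE addKb.
set s := \sum_e _; suff : s = - s.
  by move/eqP; rewrite -subr_eq0 opprK -mulr2n mulrn_eq0 /= => /eqP.
rewrite {1}/s (reindex_inj (inv_inj flipK)) -sumrN; apply: eq_bigr => e _.
rewrite /sign !ffunE eqxx (eq_sym j) (negPf ij) addFb addTb.
by case: (e i); rewrite /= expr0 expr1 ?mulNr ?mul1r ?opprK.
Qed.

(** Expand the squared modulus; by [sum_sign_mul] only the diagonal terms survive the summation over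
    e. *)
Lemma sum_sign_rnorm (z : 'I_M -> K) :
  \sum_e rnorm (\sum_i ofR (sign e i) * z i) ^+ 2 =
  2 ^+ M * \sum_i rnorm (z i) ^+ 2.
Proof.
apply: (fmorph_inj ofR); rewrite rmorph_sum rmorphM rmorph_sum /=.
under eq_bigr => e _ do rewrite rmorphXn /= ofR_rnormS -mul_conjS rmorph_sum mulr_suml.
transitivity (\sum_i \sum_j \sum_(e : signs)
    ofR (sign e i * sign e j) * (z i * conjS (z j))).
  rewrite exchange_big; apply: eq_bigr => i _.
  rewrite exchange_big; apply: eq_bigr => e _.
  rewrite mulr_sumr; apply: eq_bigr => j _.
  by rewrite rmorphM /= conjS_ofR rmorphM /=; ring.
rewrite mulr_sumr; apply: eq_bigr => i _.
under eq_bigr do rewrite -mulr_suml -rmorph_sum sum_sign_mul.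
rewrite (bigD1 i)//= eqxx big1 ?addr0 => [|j ji].
  by congr (_ * _); rewrite mul_conjS rmorphXn /= ofR_rnormS.
by rewrite eq_sym (negPf ji) rmorph0 mul0r.
Qed.

End Signs.

Section Grothendieck.
Context (R : realType) (k : scalar_kind).
Local Notation K := (scalars R k).
Local Notation ell1 := (ell1 R k).
Local Notation ell2 := (ell2 R k).
Local Notation conjS := (@conjS R k).
Local Notation ofR := (@ofR R k).
Local Notation delta := (delta R k).

Definition ell2_inner_product : inner_product ell2 :=
  InnerProduct (@dot_linear R k) (@dot_conj R k) (@dot_norm R k).

(** Transport along an enumeration of I, with a real bound b in place of the supremum. *)
Lemma grothendieck_fintype (c b : R) (I : finType) (a : I -> I -> K) (u v : I -> ell2) :
  grothendieck_bound k c -> 0 <= c ->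
  (forall i, `|u i| = 1) -> (forall i, `|v i| = 1) ->
  (forall s t : I -> K, (forall i, `|s i| <= 1) -> (forall i, `|t i| <= 1) ->
    rnorm (\sum_i \sum_j a i j * s i * t j) <= b) ->
  rnorm (\sum_i \sum_j a i j * dot (u i) (v j)) <= c * b.
Proof.
move=> gc c0 u1 v1 ab.
have E (F : I -> K) : \sum_i F i = \sum_(i < #|I|) F (enum_val i).
  by rewrite -(big_enum_val F); exact: eq_bigl.
have := gc #|I| (\matrix_(i, j) a (enum_val i) (enum_val j)) _ ell2_inner_product
  (u \o enum_val) (v \o enum_val) (fun i => u1 _) (fun j => v1 _).
rewrite (_ : \sum_i _ = \sum_i \sum_j a i j * dot (u i) (v j)); last first.
  rewrite [RHS]E; apply: eq_bigr => i _; rewrite [RHS]E; apply: eq_bigr => j _.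
  by rewrite mxE.
move=> h; rewrite -lee_fin; apply: le_trans h _; rewrite EFinM.
rewrite lee_wpmul2l ?lee_fin//; apply: ge_ereal_sup => _ [[s t] /= [s1 t1] <-].
rewrite lee_fin.
apply: le_trans (ab (s \o enum_rank) (t \o enum_rank) (fun i => s1 _) (fun j => t1 _)).
rewrite le_eqVlt; apply/orP; left; apply/eqP; congr (rnorm _).
rewrite [RHS]E; apply: eq_bigr => i _; rewrite [RHS]E; apply: eq_bigr => j _.
by rewrite mxE /= !enum_valK.
Qed.

(** For the one-by-one matrix 1 and equal unit vectors the left-hand side is 1, while scalars of
    modulus at most 1 give at most 1. A negative c is excluded first, because the supremum is
    nonnegative. *)
Lemma grothendieck_bound_ge1 (c : R) : grothendieck_bound k c -> 1 <= c.
Proof.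
move=> gc.
have d1 (i : 'I_1) : `|delta 0| = 1 by exact: ell_delta_norm.
have val1 : rnorm (dot (delta 0) (delta 0)) = 1.
  by rewrite dot_norm ell_delta_norm expr1n normr1 -(rmorph1 ofR) reS_ofR.
have c0 : 0 <= c.
  have := gc 1%N 1%:M ell2 ell2_inner_product (fun=> delta 0) (fun=> delta 0) d1 d1.
  rewrite !big_ord1 mxE eqxx mul1r /= val1 => h.
  rewrite leNgt; apply/negP => c0.
  suff /(le_trans h) : (c%:E * bilinear_sup (1%:M : 'M[K]_1) <= 0)%E.
    by rewrite lee_fin ler10.
  apply: mule_le0_ge0; first by rewrite lee_fin ltW.
  apply: ereal_sup_ubound; exists (fun=> 0, fun=> 0) => /=.
    by split=> i; rewrite normr0.
  by rewrite !big_ord1 mulr0 rnormS0.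
have := @grothendieck_fintype c 1 'I_1 (fun _ _ => 1) (fun=> delta 0) (fun=> delta 0)
  gc c0 d1 d1.
rewrite !big_ord1 mul1r val1 mulr1; apply=> s t s1 t1.
rewrite !big_ord1 mul1r rnormSM.
have le1 (z : K) : `|z| <= 1 -> rnorm z <= 1.
  by rewrite -(reS_ofR k 1) rmorph1; apply: ler_reS; exact: normr_ge0.
by rewrite -[leRHS]mulr1 ler_pM ?rnormS_ge0 ?le1.
Qed.

Section Modulation.
Variables (g : nat -> K) (x : ell2).
Hypothesis g1 : forall n, `|g n| = 1.

Lemma rnorm_modulation n : rnorm (g n * conjS (x n)) = rnorm (x n).
Proof. by rewrite normrM g1 mul1r rnorm_conjS. Qed.

Lemma lp_sum_modulation : lp_sum 2 (fun n => g n * conjS (x n)) = lp_sum 2 x.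
Proof. by apply: eq_eseriesr => n _; rewrite rnorm_modulation. Qed.

Lemma modulation_mem : (fun n => g n * conjS (x n)) \in lp_pred 2.
Proof. by apply/lp_predP; rewrite lp_sum_modulation; apply/lp_predP; exact: ell_seqP. Qed.

(** The coordinates of x are conjugated because [dot] is conjugate-linear in its second argument:
    [delta i] paired with this vector gives conj (g_i) x_i. *)
Definition modulation : ell2 := Ell (le12 R) modulation_mem.

Lemma modulation_norm : `|modulation| = `|x|.
Proof.
rewrite -(ofR_rnorm modulation) -(ofR_rnorm x); congr ofR; apply: EFin_inj.
by rewrite !ell_rnormE /lp_norm lp_sum_modulation.
Qed.

End Modulation.
End Grothendieck.

(** * Column norms bounded by a Grothendieck bound times a 2-summing constant *)

Section ColumnSums.
Context (R : realType) (k : scalar_kind).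
Local Notation K := (scalars R k).
Local Notation ell1 := (ell1 R k).
Local Notation ell2 := (ell2 R k).
Local Notation conjS := (@conjS R k).
Local Notation ofR := (@ofR R k).
Local Notation delta := (delta R k).

Variables (S : {linear ell2 -> ell2}) (T : {linear ell2 -> ell1}) (C c : R).
Hypothesis psdS : bounded_psd S.
Hypothesis TS : forall x, ell12 (T x) = S x.
Hypothesis TC : two_summing_const T C.
Hypothesis gc : grothendieck_bound k c.

Let C_ge0 : 0 <= C. Proof. by case: TC. Qed.

Section Truncation.
Variable M : nat.
Local Notation signs := {ffun 'I_M -> bool}.

(** Cauchy-Schwarz over the 2^M sign vectors reduces the claim to a sum of squares, bounded by the
    2-summing inequality. For f in the dual ball, orthogonality of signs gives 2^M times the sum of
    the |s_i f(delta_i)|^2, at most 2^M. *)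
Lemma signed_sum_le (s : 'I_M -> K) : (forall i, `|s i| <= 1) ->
  \sum_(e : signs) rnorm (T (\sum_i (ofR (sign R e i) * s i) *: delta i)) <= 2 ^+ M * C.
Proof.
move=> s1; set Q := \sum_e _.
have Q0 : 0 <= Q by apply: sumr_ge0 => e _; exact: rnorm_ge0.
have P0 : 0 <= 2 ^+ M :> R by exact: exprn_ge0.
rewrite -ler_sqr ?nnegrE ?mulr_ge0//.
have := cauchy_schwarz_sum (fun=> 1) (fun e : signs =>
  rnorm (T (\sum_i (ofR (sign R e i) * s i) *: delta i))).
under eq_bigr do rewrite mul1r.
rewrite -/Q => /le_trans; apply.
rewrite expr1n sumr_const card_signs natrX exprMn [2 ^+ M ^+ 2]expr2 -mulrA.
rewrite ler_wpM2l// [leRHS]mulrC; apply: (two_summing_le TC) => f fb.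
have fx (e : signs) : f (\sum_i (ofR (sign R e i) * s i) *: delta i) =
    \sum_i ofR (sign R e i) * (s i * f (delta i)).
  rewrite linear_sum; apply: eq_bigr => i _.
  by rewrite linearZ /= mulrA.
under eq_bigr do rewrite fx.
rewrite (sum_sign_rnorm (fun i => s i * f (delta i))) -[leRHS]mulr1 ler_wpM2l//.
apply: le_trans (dual_ball_delta M fb); apply: ler_sum => i _.
rewrite rnormSM ler_sqr ?nnegrE ?mulr_ge0 ?rnormS_ge0//.
rewrite ler_piMl ?rnormS_ge0// -(reS_ofR k 1) rmorph1.
by apply: ler_reS => //; exact: normr_ge0.
Qed.

(** The value 1 beyond M keeps the factor unimodular, so that [modulation] preserves the norm. *)
Definition sign_extension (e : signs) (n : nat) : K :=
  if insub n is Some i then ofR (sign R e i) else 1.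

Lemma norm_sign_extension e n : `|sign_extension e n| = 1.
Proof.
by rewrite /sign_extension; case: insubP => [i _ _|_]; rewrite ?norm_sign ?normr1.
Qed.

Local Notation w n := (rnorm (S (delta n))).

(** Grothendieck's inequality asks for unit vectors. When [S (delta n)] is zero, [delta 0] is put in
    its place, and the matrix entries that meet it vanish. *)
Definition test_vector (e : signs) (n : nat) : ell2 :=
  if w n == 0 then delta 0
  else modulation (ofR (w n)^-1 *: S (delta n)) (norm_sign_extension e).

Lemma test_vector_norm e n : `|test_vector e n| = 1.
Proof.
rewrite /test_vector; case: eqVneq => [_|wn]; first exact: ell_delta_norm.
rewrite modulation_norm -ofR_rnorm rnormZ rnorm_ofR ?invr_ge0 ?rnorm_ge0//.
by rewrite mulVf// rmorph1.
Qed.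

(** The sign of the matrix entry cancels that of the test vector, and self-adjointness gives (S
    delta_i)_n = conj ((S delta_n)_i). For w_n = 0 both sides are 0. *)
Lemma sign_test_vector e (i : 'I_M) n :
  ofR (sign R e i) * S (delta i) n * dot (delta i) (test_vector e n) =
  ofR (rnorm (S (delta n) i) ^+ 2 / w n).
Proof.
have Sin : S (delta i) n = conjS (S (delta n) i).
  by rewrite (sqrt_coord psdS) dot_conj dot_delta.
rewrite dot_conj dot_delta /test_vector; case: eqVneq => [wn|wn].
  have z : S (delta n) i = 0 by rewrite (rnorm0_eq0 wn).
  by rewrite Sin z rmorph0 mulr0 mul0r rnormS0 expr0n mul0r rmorph0.
have -> : modulation (ofR (w n)^-1 *: S (delta n)) (norm_sign_extension e) i =
    ofR (sign R e i) * conjS (ofR (w n)^-1 * S (delta n) i).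
  rewrite -[LHS]/(sign_extension e i * conjS (ofR (w n)^-1 * S (delta n) i)).
  by rewrite /sign_extension valK.
rewrite Sin !rmorphM /= !conjS_ofR conjSK.
transitivity (ofR (sign R e i * sign R e i) * ofR (w n)^-1 *
    (S (delta n) i * conjS (S (delta n) i))).
  by rewrite rmorphM; ring.
by rewrite sign_sqr rmorph1 mul1r mul_conjS expr2 !ofR_rnormS mulrC.
Qed.

Lemma truncated_column_sum_le :
  \sum_(n < M) \sum_(i < M) rnorm (S (delta n) i) ^+ 2 / w n <= c * C.
Proof.
(* [grothendieck_bound] takes square matrices, so rows and columns are both indexed by pairs; all
   rows are zero except those carrying the fixed [e0], which stand for the indices i alone. *)
pose e0 : signs := [ffun=> true].
pose I : finType := (signs * 'I_M)%type.
pose a (p q : I) : K := if p.1 == e0 then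
  ofR (2 ^+ M)^-1 * (ofR (sign R q.1 p.2) * S (delta p.2) q.2) else 0.
have c0 : 0 <= c by apply: le_trans (grothendieck_bound_ge1 gc); exact: ler01.
have P0 : 0 < 2 ^+ M :> R by rewrite exprn_gt0.
have sumI (V : nmodType) (F : I -> V) : \sum_p F p = \sum_e \sum_i F (e, i).
  by rewrite pair_bigA; apply: eq_bigr => -[].
have sum_a (F : I -> I -> K) : \sum_p \sum_q a p q * F p q =
    \sum_(e : signs) \sum_(n < M) \sum_(i < M)
      ofR (2 ^+ M)^-1 * (ofR (sign R e i) * S (delta i) n * F (e0, i) (e, n)).
  rewrite sumI (bigD1 e0)//= [X in _ + X]big1 ?addr0 => [|e ee0]; last first.
    by rewrite big1// => i _; rewrite big1// => q _; rewrite /a /= (negPf ee0) mul0r.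
  under eq_bigr do rewrite sumI.
  rewrite exchange_big; apply: eq_bigr => e _.
  rewrite exchange_big; apply: eq_bigr => n _; apply: eq_bigr => i _.
  by rewrite /a /= eqxx -mulrA.
have := @grothendieck_fintype R k c C I a (fun p => delta p.2)
  (fun q => test_vector q.1 q.2) gc c0 (fun p => ell_delta_norm _ _ _)
  (fun q => test_vector_norm _ _).
rewrite sum_a /=.
under eq_bigr => e _ do under eq_bigr => n _ do under eq_bigr => i _ do
  rewrite sign_test_vector -rmorphM.
under eq_bigr => e _ do under eq_bigr => n _ do rewrite -rmorph_sum -mulr_sumr.
under eq_bigr => e _ do rewrite -rmorph_sum -mulr_sumr.
(* The inner sums no longer depend on e, and the 2^M equal terms cancel the factor 2^-M. *)
rewrite sumr_const card_signs -rmorphMn -mulr_natl natrX mulrA mulfV ?gt_eqF// mul1r.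
rewrite rnorm_ofR; last first.
  apply: sumr_ge0 => n _; apply: sumr_ge0 => i _.
  by rewrite mulr_ge0 ?sqr_ge0 ?invr_ge0 ?rnorm_ge0.
apply=> s t s1 t1.
rewrite (eq_bigr (fun p => \sum_q a p q * (s p * t q))); last first.
  by move=> p _; apply: eq_bigr => q _; rewrite mulrA.
rewrite sum_a /=; apply: le_trans (@rnorm_sum R k K^o _ _ _ _) _.
rewrite -(ler_pM2l P0).
apply: le_trans (signed_sum_le (fun i => s1 (e0, i))).
rewrite mulr_sumr; apply: ler_sum => e _.
(* For fixed e and n, the sum over i is 2^-M [t (e, n)] times the n-th coordinate of [T x]; summing
   over n gives at most 2^-M times the l1 norm of [T x]. *)
pose x : ell2 := \sum_i (ofR (sign R e i) * s (e0, i)) *: delta i.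
have Tx n : T x n = \sum_i ofR (sign R e i) * s (e0, i) * S (delta i) n.
  rewrite (two_summing_coord TS) -dot_delta linear_sum dot_suml.
  by apply: eq_bigr => i _; rewrite linearZ dotZl dot_delta.
apply: le_trans (ell1_partial (T x) M).
rewrite -ler_pdivlMl//; apply: le_trans (@rnorm_sum R k K^o _ _ _ _) _.
rewrite mulr_sumr; apply: ler_sum => n _.
rewrite (_ : \sum_i _ = ofR (2 ^+ M)^-1 * (T x n * t (e, n))); last first.
  rewrite Tx mulr_suml mulr_sumr; apply: eq_bigr => i _.
  by congr (_ * _); ring.
rewrite !rnormSM rnorm_ofR ?invr_ge0 ?(ltW P0)// ler_wpM2l ?invr_ge0 ?(ltW P0)//.
rewrite ler_piMr ?rnormS_ge0// -(reS_ofR k 1) rmorph1.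
by apply: ler_reS => //; exact: normr_ge0.
Qed.

End Truncation.

(** With N columns fixed and the number M of coordinates going to infinity, the inner sums tend to
    |S delta_n|^2, and |S delta_n|^2 / w_n = w_n, also for w_n = 0. *)
Lemma column_sum_grothendieck N : \sum_(n < N) rnorm (S (delta n)) <= c * C.
Proof.
pose F M := \sum_(n < N) (\sum_(i < M) rnorm (S (delta n) i) ^+ 2) / rnorm (S (delta n)).
(* Truncating at M + N >= N ensures that the N columns are among those of
   [truncated_column_sum_le]. *)
have FN M : F (M + N)%N <= c * C.
  apply: le_trans (truncated_column_sum_le (M + N)).
  under [leRHS]eq_bigr do rewrite -mulr_suml.
  rewrite /F -!(big_mkord xpredT (fun n => (\sum_(i < M + N) rnorm (S (delta n) i) ^+ 2) /
    rnorm (S (delta n)))) [leRHS](big_cat_nat (leq0n N)) ?leq_addl//= lerDl.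
  apply: sumr_ge0 => n _; rewrite mulr_ge0 ?invr_ge0 ?rnorm_ge0//.
  by apply: sumr_ge0 => i _; exact: sqr_ge0.
have Fl : F @ \oo --> \sum_(n < N) rnorm (S (delta n)) ^+ 2 / rnorm (S (delta n)).
  apply: cvg_big => [|n _]; first exact: add_continuous.
  by apply: cvgMl; exact: ell2_cvg.
have -> : \sum_(n < N) rnorm (S (delta n)) =
    \sum_(n < N) rnorm (S (delta n)) ^+ 2 / rnorm (S (delta n)).
  apply: eq_bigr => n _; have [->|wn] := eqVneq (rnorm (S (delta n))) 0.
    by rewrite expr0n mul0r.
  by rewrite expr2 mulfK.
have FlN : (fun M => F (M + N)%N) @ \oo -->
    \sum_(n < N) rnorm (S (delta n)) ^+ 2 / rnorm (S (delta n)).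
  by rewrite (cvg_shiftn N F).
exact: cvg_le_cst FlN FN.
Qed.

End ColumnSums.

(** * Passage from admissible constants to [kappa_G] and [pi2] *)

Section Constants.
Context (R : realType) (k : scalar_kind).
Local Notation K := (scalars R k).
Local Notation ell1 := (ell1 R k).
Local Notation ell2 := (ell2 R k).
Local Notation delta := (delta R k).

Variables (S : {linear ell2 -> ell2}) (T : {linear ell2 -> ell1}).
Hypothesis psdS : bounded_psd S.
Hypothesis TS : forall x, ell12 (T x) = S x.
Hypothesis Tsum : two_summing T.

(** A single term of the sum in [two_summing_delta]. It settles the case where [pi2] is 0. *)
Lemma column_le_two_summing C n : two_summing_const T C -> rnorm (S (delta n)) <= C.
Proof.
move=> TC; have [C0 _] := TC.
rewrite -TS; apply: le_trans (ell12_rnorm_le _) _.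
rewrite -ler_sqr ?nnegrE ?rnorm_ge0//; apply: le_trans (two_summing_delta n.+1 TC).
by rewrite big_ord_recr /= lerDr sumr_ge0// => i _; rewrite sqr_ge0.
Qed.

(** The series is at most c C for all admissible c and C; dividing by one factor at a time allows
    the two infima to be taken separately. *)
Lemma column_series_le_kappa_pi2 :
  (\sum_(0 <= n <oo) (rnorm (S (delta n)))%:E <= kappa_G R k * pi2 T)%E.
Proof.
have kappa1 : (1 <= kappa_G R k)%E.
  by apply/ereal_infP => _ [c gc <-]; rewrite lee_fin (grothendieck_bound_ge1 gc).
have pi0 : (0 <= pi2 T)%E by apply/ereal_infP => _ [C [C0 _] <-]; rewrite lee_fin.
have w0 n : 0 <= rnorm (S (delta n)) by exact: rnorm_ge0.
have le_cC c C : grothendieck_bound k c -> two_summing_const T C ->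
    (\sum_(0 <= n <oo) (rnorm (S (delta n)))%:E <= (c * C)%:E)%E.
  move=> gc TC; apply: nneseries_le => // n.
  by rewrite lee_fin; exact: column_sum_grothendieck psdS TS TC gc n.
have [C TC] := Tsum.
have pifin : pi2 T \is a fin_num.
  rewrite ge0_fin_numE//; apply: (@le_lt_trans _ _ C%:E); last exact: ltry.
  by apply: ereal_inf_lbound; exists C.
(* In [\bar R] a product with 0 is 0 even if the other factor is infinite, so here each column has
   to vanish. *)
have [piz|pin] := eqVneq (pi2 T) 0%E.
  rewrite piz mule0 eseries0// => n _ _; congr EFin; apply/eqP.
  rewrite eq_le w0 andbT -lee_fin.
  have : ((rnorm (S (delta n)))%:E <= pi2 T)%E.
    by apply/ereal_infP => _ [B TB <-]; rewrite lee_fin column_le_two_summing.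
  by rewrite piz.
have pigt : (0 < pi2 T)%E by rewrite lt0e pin.
have [kfin|] := boolP (kappa_G R k \is a fin_num); last first.
  rewrite ge0_fin_numE ?(le_trans _ kappa1) ?lee_fin// -leNgt leye_eq => /eqP ->.
  by rewrite gt0_mulye// leey.
have /ereal_inf_lt [_ [c gc _] _] : (kappa_G R k < +oo)%E.
  by rewrite -ge0_fin_numE// (le_trans _ kappa1) ?lee_fin.
have Dfin : (\sum_(0 <= n <oo) (rnorm (S (delta n)))%:E)%E \is a fin_num.
  rewrite ge0_fin_numE ?(le_lt_trans (le_cC _ _ gc TC)) ?ltry//.
  by apply: nneseries_ge0 => n _ _; rewrite lee_fin.
move: le_cC; rewrite -(fineK Dfin); set d := fine _ => le_cC.
move: kappa1 pigt; rewrite -(fineK kfin) -(fineK pifin).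
set q := fine (kappa_G R k); set p := fine (pi2 T); rewrite !lee_fin lte_fin => q1 p0.
have q0 : 0 < q by exact: lt_le_trans q1.
(* First the infimum over the 2-summing constants B, then the one over the Grothendieck bounds a. *)
rewrite -ler_pdivrMl// -lee_fin /p fineK//; apply/ereal_infP => _ [B TB <-].
have B0 : 0 < B.
  apply: lt_le_trans p0 _; rewrite -lee_fin fineK//.
  by apply: ereal_inf_lbound; exists B.
rewrite lee_fin ler_pdivrMl// -ler_pdivrMr// -lee_fin /q fineK//.
apply/ereal_infP => _ [a ga <-]; rewrite lee_fin ler_pdivrMr// -lee_fin.
exact: le_cC.
Qed.

End Constants.

Theorem theorem5p18 (R : realType) (k : scalar_kind)
    (A : {linear ell2 R k -> ell2 R k}) (hA : bounded_psd A) :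
  let D : \bar R := (\sum_(0 <= n <oo)
    (Num.sqrt (reS (dot (A (delta R k n)) (delta R k n))))%:E)%E in
  ((D < +oo)%E ->
    (exists T : {linear ell2 R k -> ell1 R k},
      [/\ forall x, ell12 (T x) = sqrt_op A x, two_summing T
        & (pi2 T <= D)%E]) /\
    Gamma_plus A /\ (gamma_plus A <= D ^+ 2)%E) /\
  (forall T : {linear ell2 R k -> ell1 R k},
    (forall x, ell12 (T x) = sqrt_op A x) -> two_summing T ->
    Gamma_plus A /\ (D <= kappa_G R k * pi2 T)%E).
Proof.
have [psdS SS] := sqrt_opP hA.
set S := sqrt_op A in psdS SS *; move=> D.
(* <A delta_n, delta_n> = |S delta_n|^2, so D is the sum of the column norms of S. *)
have DE : D = (\sum_(0 <= n <oo) (rnorm (S (delta R k n)))%:E)%E.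
  apply: eq_eseriesr => n _; rewrite (dot_sqrt psdS SS) re_dot sqrtr_sqr.
  by rewrite ger0_norm ?rnorm_ge0.
split=> [Doo|T TS Tsum]; last first.
  split; last by rewrite DE; exact: column_series_le_kappa_pi2.
  by have [C TC] := Tsum; exact (Gamma_plus_sqrt hA psdS SS TS TC).
have D0 : (0 <= D)%E by apply: nneseries_ge0 => n _ _; rewrite lee_fin sqrtr_ge0.
have dE : (\sum_(0 <= n <oo) (rnorm (S (delta R k n)))%:E)%E = (fine D)%:E.
  by rewrite fineK ?ge0_fin_numE.
have TC := sqrt_two_summing psdS dE.
have TS := sqrt_to_ell1E psdS dE.
split; last split.
- exists (sqrt_to_ell1 psdS dE); split=> //; first by exists (fine D).
  rewrite -[leRHS]fineK ?ge0_fin_numE//.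
  by apply: ereal_inf_lbound; exists (fine D).
- exact (Gamma_plus_sqrt hA psdS SS TS TC).
- rewrite -(fineK (x := D)) ?ge0_fin_numE// -EFin_expe.
  exact (gamma_plus_sqrt psdS SS TS TC).
Qed.
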